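(* For every $k\in\mathbb N$ there is a constant $C(k)>0$, depending only on $k$, such that the following holds. Let $n,d\in\mathbb N$ and let $\mu=\mu_1\otimes\cdots\otimes\mu_n$, where each $\mu_j$ is a probability measure on $\mathbb R$ having a bounded unimodal density $\varrho_j$. Set \[ M:=\max_{1\le j\le n}\|\varrho_j\|_\infty. \] Then, for every $f\in\mathcal P_d(\mathbb R^n)$, one has \[ \|\nabla f\|_{L^{2k}(\mu)}\le C(k)\,M\,d^2\,\|f\|_{L^{2k}(\mu)}. \] One may take $C(1)=24$ and $C(k)=736k^3$ for $k\ge2$.
   Context: $\mathbb N=\{1,2,\dots\}$. $\mathcal P_d(\mathbb R^n)$ is the space of all real algebraic polynomials in $n$ variables of (total) degree at most $d$. A density $\varrho$ on $\mathbb R$ (with respect to Lebesgue measure) is called unimodal if there exists $x_0\in\mathbb R$ such that $\varrho$ is nondecreasing on $(-\infty,x_0]$ and nonincreasing on $[x_0,\infty)$. $\|\nabla f\|_{L^{2k}(\mu)}=\bigl(\int|\nabla f|^{2k}\,d\mu\bigr)^{1/(2k)}$ with $|\cdot|$ the Euclidean norm; the norms take values in $[0,+\infty]$. *)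

(* Defs.v *)
From HB Require Import structures.
From mathcomp Require Import all_boot all_order all_algebra.
From mathcomp Require Import all_classical all_reals all_analysis.
(* the notations of mpoly clash with those of mathcomp-analysis *)
From mathcomp.multinomials Require Import -(notations) mpoly.

Set Implicit Arguments.
Unset Strict Implicit.
Unset Printing Implicit Defensive.

Import Order.TTheory GRing.Theory Num.Theory.
Import numFieldNormedType.Exports.

Local Open Scope classical_set_scope.
Local Open Scope ring_scope.

Section ProductProbability.
Context {d : measure_display} {T : measurableType d} {R : realType}.

Definition tuple_cons (n : nat) (x : T * n.-tuple T) : n.+1.-tuple T :=
  [the n.+1.-tuple T of x.1 :: x.2].

Lemma measurable_tuple_cons (n : nat) :
  measurable_fun [set: T * n.-tuple T] (@tuple_cons n).
Proof. exact: measurable_cons. Qed.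

HB.instance Definition _ (n : nat) :=
  isMeasurableFun.Build _ _ _ _ (@tuple_cons n) (@measurable_tuple_cons n).

(* P_0 (x) ... (x) P_(n-1): the image under tuple_cons of the binary product of
   P_0 and P_1 (x) ... (x) P_(n-1). Its values on boxes, which determine it, are
   given by prod_probabilityE. *)
Fixpoint prod_probability (n : nat) :
    ('I_n -> probability T R) -> probability (n.-tuple T) R :=
  match n with
  | 0 => fun _ => @dirac _ (0.-tuple T) [tuple] R
  | m.+1 => fun P =>
      distribution
        (P ord0 \x prod_probability (fun i => P (lift ord0 i)))%E
        (@tuple_cons m)
  end.

Lemma prod_probabilityE (n : nat) (P : 'I_n -> probability T R)
    (A : 'I_n -> set T) : (forall i, measurable (A i)) ->
  prod_probability P [set x | forall i, A i (tnth x i)] =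
  (\prod_(i < n) P i (A i))%E.
Proof.
elim: n P A => [|n IH] P A mA.
  by rewrite big_ord0 /= diracE mem_set//= => -[].
rewrite big_ord_recl /= /distribution /pushforward /=.
rewrite -(IH _ (fun i => A (lift ord0 i)))//.
rewrite -product_measure1E//; last first.
  rewrite (_ : [set _ | _] = \bigcap_(i in [set: 'I_n])
      ((fun x => tnth x i) @^-1` A (lift ord0 i))); last first.
    by apply/seteqP; split => x /= H i; [move=> _; exact: H|exact: (H i I)].
  apply: fin_bigcap_measurable => // i _.
  by rewrite -[X in measurable X]setTI; apply: measurable_tnth.
congr (product_measure1 _ _ _); apply/seteqP; split => -[x y] /=.
  move=> H; split; first exact: (H ord0).
  by move=> i; have := H (lift ord0 i); rewrite tnthS.
by move=> [H0 H] i; case: (unliftP ord0 i) => [j|] -> //; rewrite tnthS.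
Qed.

End ProductProbability.

Section Densities.
Context {R : realType}.

Definition has_density (mu : probability (measurableTypeR R) R)
    (rho : R -> R) : Prop :=
  [/\ measurable_fun [set: measurableTypeR R] rho,
      forall x, 0 <= rho x &
      forall A : set (measurableTypeR R), measurable A ->
        mu A = (\int[lebesgue_measure]_(x in A) (rho x)%:E)%E].

Definition unimodal (rho : R -> R) : Prop :=
  exists x0 : R,
    {in `]-oo, x0] &, nondecreasing_fun rho} /\
    {in `[x0, +oo[ &, nonincreasing_fun rho}.

End Densities.

Section Polynomials.
Context {R : realType} {n : nat}.
Implicit Types (f : mpoly n R) (x : n.-tuple (measurableTypeR R)).

(* msize is 1 + total degree, and 0 for the zero polynomial *)
Definition degree_le (d : nat) f : Prop := (msize f <= d.+1)%N.

Definition poly_fun f x : R := meval (tnth x) f.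

Definition grad_norm f x : R :=
  Num.sqrt (\sum_(i < n) poly_fun (mderiv i f) x ^+ 2).

End Polynomials.

(* Main.v *)
Require Import Defs.
From mathcomp Require Import all_boot all_order all_algebra.
From mathcomp Require Import all_classical all_reals all_analysis.
From mathcomp.multinomials Require Import -(notations) mpoly.
From mathcomp Require Import measurable_realfun ess_sup_inf.
From mathcomp Require Import ring lra zify.

Set Implicit Arguments.
Unset Strict Implicit.
Unset Printing Implicit Defensive.

Import Order.TTheory GRing.Theory Num.Theory.
Import numFieldNormedType.Exports.
Local Open Scope classical_set_scope.
Local Open Scope ring_scope.

(** The exponent 2k is even, so both norms are integrals of polynomials, and
    these do not change when each one-dimensional law is replaced by a suitable
    mixture of laws of c + r cos(phi), with phi uniform on the circle.

    Such a mixture exists by [arcsine_mixture]. A unimodal density is a mixture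
    of the uniform laws on its level sets, which are intervals [a, b]; and if x
    is uniform on [a, b], then so is c + r cos(phi), where c is the midpoint and
    r^2 = (x - a)(b - x), because both are coordinates of a uniform point of a
    sphere ([archimedes]).

    For fixed centres c_i and radii r_i the polynomial f becomes a function on a
    torus. Turning all the angles at once, f is a trigonometric polynomial of
    degree at most d in a single variable, so Bernstein's inequality bounds the
    moments of the sum of the r_i sin(phi_i) d_i f by those of 2 d f, whatever
    the dimension is ([torus_bernstein]). Reflections of single angles turn this
    sum into the square function of its terms ([torus_square_function]). The
    weights sin(phi_i)^2 are then removed at the cost of a second factor of
    order k d ([torus_weight_removal]), one coordinate at a time. The result
    is [torus_markov], a bound for the moments of the sum of the
    r_i^2 (d_i f)^2.

    It remains to replace r_i by a multiple of 1 / M. The lengths of the level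
    sets {rho > s} integrate to 1 over 0 < s < M and are nonincreasing in s, so
    that their mean over 0 < s < rho(x) is at least 1 / M, and so are the
    corresponding power means ([jensen_width]); the mean of r^2 over a level set
    is comparable to the square of its length ([archimedes_power]). When the
    k-th power of |grad f|^2 is expanded, each term is a square times a product
    over the coordinates of powers of radii, so that these one-dimensional
    comparisons multiply ([mixture_rel_tensor], [integral_gradient_le]). Their
    product is (8 M^2)^k, the torus contributes (8 k d^2)^(2k), and
    8 (8 k)^2 <= C(k)^2.

    The angles run over a finite grid. A sum over N + 1 equally spaced angles is
    exact for trigonometric polynomials of degree at most N, so the analysis on
    the torus consists of identities and inequalities between finite sums. *)

(** * Power inequalities *)

Section PowerInequalities.
Context {R : realType}.

(** The tangent of the (p+1)-st power at a; it does the work of the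
    inequalities of Hoelder and Jensen below. *)
Lemma young_expr (p : nat) (a x : R) : 0 <= a -> 0 <= x ->
  p.+1%:R * a ^+ p * x <= x ^+ p.+1 + p%:R * a ^+ p.+1.
Proof.
move=> a0 x0; elim: p => [|p IH]; first by rewrite expr0 expr1 mul0r !mul1r addr0.
have H2 := ler_wpM2r x0 IH.
have H : 0 <= p.+1%:R * a ^+ p * (x - a) ^+ 2.
  by rewrite mulr_ge0 ?sqr_ge0 // mulr_ge0 ?exprn_ge0.
rewrite -subr_ge0.
rewrite -subr_ge0 in H2; apply: le_trans (addr_ge0 H2 H) _.
rewrite le_eqVlt; apply/orP; left; apply/eqP.
rewrite -!natr1 !exprS; ring.
Qed.

(** Jensen's inequality for weights of total mass at most L: add up the
    tangents at the weighted sum divided by L. *)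
Lemma expr_sum_le (I : finType) (w x : I -> R) (L : R) (p : nat) :
  0 < L -> (forall i, 0 <= w i) -> \sum_i w i <= L -> (forall i, 0 <= x i) ->
  (\sum_i w i * x i) ^+ p.+1 <= L ^+ p * \sum_i w i * x i ^+ p.+1.
Proof.
move=> L0 w0 wL x0.
set s := \sum_i w i * x i.
have s0 : 0 <= s by apply: sumr_ge0 => i _; rewrite mulr_ge0.
pose a := s / L.
have a0 : 0 <= a by rewrite divr_ge0 // ltW.
have sE : s = a * L by rewrite /a divfK // gt_eqF.
have H : \sum_i w i * (p.+1%:R * a ^+ p * x i) <=
         \sum_i w i * (x i ^+ p.+1 + p%:R * a ^+ p.+1).
  by apply: ler_sum => i _; rewrite ler_wpM2l //; exact: young_expr.
have E1 : \sum_i w i * (p.+1%:R * a ^+ p * x i) = p.+1%:R * a ^+ p * s.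
  by rewrite mulr_sumr; apply: eq_bigr => i _; rewrite mulrCA.
have E2 : \sum_i w i * (x i ^+ p.+1 + p%:R * a ^+ p.+1) =
   \sum_i w i * x i ^+ p.+1 + (\sum_i w i) * (p%:R * a ^+ p.+1).
  by rewrite mulr_suml -big_split; apply: eq_bigr => i _; rewrite mulrDr.
rewrite E1 E2 in H.
have H3 : (\sum_i w i) * (p%:R * a ^+ p.+1) <= L * (p%:R * a ^+ p.+1).
  by rewrite ler_wpM2r // mulr_ge0 ?exprn_ge0.
have H4 : a ^+ p.+1 * L <= \sum_i w i * x i ^+ p.+1.
  have : p.+1%:R * a ^+ p * s <= \sum_i w i * x i ^+ p.+1 + L * (p%:R * a ^+ p.+1).
    by apply: le_trans H _; rewrite lerD2l.
  rewrite sE -natr1 !exprS => H5.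
  set S := \sum_i _ in H5 *; rewrite -subr_ge0; rewrite -subr_ge0 in H5.
  by apply: le_trans H5 _; rewrite le_eqVlt; apply/orP; left; apply/eqP; ring.
rewrite sE exprMn.
have -> : a ^+ p.+1 * L ^+ p.+1 = L ^+ p * (a ^+ p.+1 * L) by rewrite (exprS L); ring.
by rewrite ler_wpM2l // exprn_ge0 // ltW.
Qed.

End PowerInequalities.

(** * Trigonometric polynomials *)

Section TrigPoly.
Context {R : realType}.
Implicit Types (g dg h dh : R -> R).

(** A trigonometric polynomial of degree at most D, paired with its derivative.
    Presenting the space as the span of phase-shifted cosines leaves a single
    kind of generator on which linear identities have to be checked. *)
Inductive trig_poly (D : nat) : (R -> R) -> (R -> R) -> Prop :=
| TrigCos (j : nat) (a : R) of (j <= D)%N :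
    trig_poly D (fun t => cos (j%:R * t + a)) (fun t => - (j%:R * sin (j%:R * t + a)))
| TrigLin (u : R) g dg h dh of trig_poly D g dg & trig_poly D h dh :
    trig_poly D (fun t => u * g t + h t) (fun t => u * dg t + dh t).

Lemma trig_poly_ext D g dg g' dg' : trig_poly D g dg ->
  g =1 g' -> dg =1 dg' -> trig_poly D g' dg'.
Proof. by move=> H /funext <- /funext <-. Qed.

Lemma trig_poly_le D D' g dg : (D <= D')%N -> trig_poly D g dg -> trig_poly D' g dg.
Proof.
move=> DD'; elim=> [j a jD|u g1 dg1 h dh _ H1 _ H2].
  by apply: TrigCos; exact: leq_trans jD DD'.
exact: TrigLin.
Qed.

Lemma trig_poly_cst D (c : R) : trig_poly D (fun=> c) (fun=> 0).
Proof.
have H0 : trig_poly D (fun t => cos (0%:R * t + 0)) (fun t => - (0%:R * sin (0%:R * t + 0))).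
  exact: TrigCos.
apply: (trig_poly_ext (TrigLin (c - 1) H0 H0)) => t /=; rewrite !mul0r ?addr0 ?cos0; ring.
Qed.

Lemma trig_polyD D g dg h dh : trig_poly D g dg -> trig_poly D h dh ->
  trig_poly D (fun t => g t + h t) (fun t => dg t + dh t).
Proof.
by move=> Hg Hh; apply: (trig_poly_ext (TrigLin 1 Hg Hh)) => t; rewrite mul1r.
Qed.

Lemma trig_polyZ D u g dg : trig_poly D g dg ->
  trig_poly D (fun t => u * g t) (fun t => u * dg t).
Proof.
move=> Hg; apply: (trig_poly_ext (TrigLin u Hg (trig_poly_cst D 0))) => t;
  by rewrite addr0.
Qed.

Lemma trig_poly_cosM i j a b :
  trig_poly (i + j) (fun t => cos (i%:R * t + a) * cos (j%:R * t + b))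
    (fun t => - (i%:R * sin (i%:R * t + a)) * cos (j%:R * t + b)
              + cos (i%:R * t + a) * - (j%:R * sin (j%:R * t + b))).
Proof.
wlog ij : i j a b / (j <= i)%N.
  move=> W; case: (leqP j i) => [/W//|/ltnW/W H].
  by rewrite addnC; apply: (trig_poly_ext (H b a)) => t; ring.
have Hs : trig_poly (i + j) _ _ := @TrigCos (i + j) (i + j)%N (a + b) (leqnn _).
have Hd : trig_poly (i + j) _ _ :=
  @TrigCos (i + j) (i - j)%N (a - b) (leq_trans (leq_subr _ _) (leq_addr _ _)).
apply: (trig_poly_ext (trig_polyZ (1/2) (trig_polyD Hs Hd))) => t /=.
  have -> : (i + j)%:R * t + (a + b) = (i%:R * t + a) + (j%:R * t + b).
    by rewrite natrD; ring.
  have -> : (i - j)%:R * t + (a - b) = (i%:R * t + a) - (j%:R * t + b).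
    by rewrite natrB //; ring.
  by rewrite cosD cosB; field.
have -> : (i + j)%:R * t + (a + b) = (i%:R * t + a) + (j%:R * t + b).
  by rewrite natrD; ring.
have -> : (i - j)%:R * t + (a - b) = (i%:R * t + a) - (j%:R * t + b).
  by rewrite natrB //; ring.
by rewrite sinD sinB natrD natrB //; field.
Qed.

Lemma trig_polyM D E g dg h dh : trig_poly D g dg -> trig_poly E h dh ->
  trig_poly (D + E) (fun t => g t * h t) (fun t => dg t * h t + g t * dh t).
Proof.
elim=> [i a iD|u g1 dg1 g2 dg2 _ IH1 _ IH2] Hh; last first.
  by apply: (trig_poly_ext (TrigLin u (IH1 Hh) (IH2 Hh))) => t; ring.
elim: Hh => [j b jE|u h1 dh1 h2 dh2 _ IH1 _ IH2].
  by apply: trig_poly_le (trig_poly_cosM i j a b); rewrite leq_add.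
by apply: (trig_poly_ext (TrigLin u IH1 IH2)) => t; ring.
Qed.

Lemma trig_poly_prod D k (g dg : 'I_k -> R -> R) :
  (forall j, trig_poly D (g j) (dg j)) ->
  exists dG, trig_poly (k * D) (fun t => \prod_j g j t) dG.
Proof.
elim: k g dg => [|k IH] g dg H.
  exists (fun=> 0); apply: (trig_poly_ext (trig_poly_cst _ 1)) => t //.
  by rewrite big_ord0.
have [dG HG] := IH _ _ (fun j => H (lift ord0 j)).
eexists; apply: (trig_poly_ext (trig_polyM (H ord0) HG)) => t; last by [].
by rewrite big_ord_recl.
Qed.

Lemma trig_poly_cos1 a :
  trig_poly 1 (fun t => cos (t + a)) (fun t => - sin (t + a)).
Proof.
by apply: (trig_poly_ext (@TrigCos 1 1 a (leqnn _))) => t; rewrite !mul1r.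
Qed.

Lemma trig_poly_sin1 : trig_poly 1 (@sin R) (@cos R).
Proof.
apply: (trig_poly_ext (trig_poly_cos1 (- (pi / 2)))) => t.
  by rewrite cosBpihalf.
by rewrite sinBpihalf opprK.
Qed.

Lemma trig_poly_periodic D g dg : trig_poly D g dg -> periodic g (pi *+ 2).
Proof.
elim=> [j a _|u g1 dg1 h dh _ H1 _ H2] t; last by rewrite H1 H2.
have -> : j%:R * (t + pi *+ 2) + a = (j%:R * t + a) + (pi *+ 2) *+ j.
  by rewrite -[in RHS]mulr_natl; ring.
by rewrite periodicn //; exact: cosD2pi.
Qed.

End TrigPoly.

(** * Equally spaced points on the circle *)

Section Grid.
Context {R : realType}.
Variable N : nat.
Local Notation n := N.+1.

Definition grid (m : 'I_n) : R := (pi *+ 2) * m%:R / n%:R.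

(** The sum of indices is taken modulo the size of the grid, so it matches the
    sum of angles up to multiples of a full turn. *)
Lemma gridD (f : R -> R) (x : R) (i j : 'I_n) : periodic f (pi *+ 2) ->
  f (x + grid (i + j)) = f (x + (grid i + grid j)).
Proof.
move=> pf.
have -> : grid i + grid j = grid (i + j) + (pi *+ 2) *+ ((i + j) %/ n).
  rewrite /grid /= -mulrDl -mulrDr -natrD.
  rewrite {1}(divn_eq (i + j) n) natrD natrM -[in RHS]mulr_natl.
  have n0 : n%:R != 0 :> R by rewrite pnatr_eq0.
  set q := (_ %/ _)%N; set r := (_ %% _)%N; move: q r n0 => q r n0.
  by field.
by rewrite addrA periodicn.
Qed.

Lemma sum_grid_shift (f : R -> R) (j : 'I_n) : periodic f (pi *+ 2) ->
  \sum_(i < n) f (grid i + grid j) = \sum_(i < n) f (grid i).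
Proof.
move=> pf; rewrite [RHS](reindex_inj (addIr j)); apply: eq_bigr => i _.
by rewrite -[in RHS](add0r (grid _)) gridD // add0r.
Qed.

(** Multiplied by twice the sine of half a step, the sum telescopes over a
    whole number of turns. *)
Lemma sum_cos_grid_nat (a : nat) (b : R) : (0 < a < n)%N ->
  \sum_(m < n) cos (a%:R * grid m + b) = 0.
Proof.
move=> /andP[a0 an].
pose x : R := pi * a%:R / n%:R.
have n0 : n%:R != 0 :> R by rewrite pnatr_eq0.
have sx : sin x != 0.
  rewrite gt_eqF // sin_gt0_pi //; apply/andP; split.
    by rewrite divr_gt0 // mulr_gt0 ?pi_gt0 ?ltr0n.
  by rewrite ltr_pdivrMr ?ltr0n // ltr_pM2l ?pi_gt0 // ltr_nat.
have T : forall k : nat, 2 * sin x * \sum_(m < k) cos (2 * x * m%:R + b) =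
   sin (2 * x * k%:R - x + b) - sin (b - x).
  elim=> [|k IH].
    by rewrite big_ord0 mulr0n !mulr0 add0r (addrC (- x)) subrr.
  rewrite big_ord_recr /= mulrDr IH.
  have -> : 2 * x * k.+1%:R - x + b = (2 * x * k%:R + b) + x.
    by rewrite -natr1; ring.
  have -> : 2 * x * k%:R - x + b = (2 * x * k%:R + b) - x by ring.
  set A := 2 * x * k%:R + b.
  by rewrite (sinD A x) (sinB A x); ring.
have := T n.
have -> : 2 * x * n%:R - x + b = (b - x) + (pi *+ 2) *+ a.
  by rewrite -[_ *+ a]mulr_natl /x; field.
rewrite periodicn; last exact: sinD2pi.
rewrite subrr => /eqP; rewrite mulf_eq0 mulf_eq0 (negbTE sx) pnatr_eq0 /= => /eqP H.
rewrite -[RHS]H; apply: eq_bigr => m _; congr (cos (_ + _)).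
by rewrite /grid /x; field.
Qed.

Lemma sum_cos_grid (a : int) (b : R) : (`|a| < n)%N ->
  \sum_(m < n) cos (a%:~R * grid m + b) = (a == 0)%:R * n%:R * cos b.
Proof.
have P (k : nat) c : (k < n)%N ->
    \sum_(m < n) cos (k%:R * grid m + c) = (k == 0)%:R * n%:R * cos c.
  case: k => [_|k kn]; last first.
    by rewrite sum_cos_grid_nat //= mulr0n !mul0r.
  under eq_bigr do rewrite mulr0n mul0r add0r.
  by rewrite sumr_const card_ord mul1r mulr_natl.
case: (intP a) => [|k|k] H.
- by rewrite (P 0%N).
- by rewrite -pmulrn (P k.+1).
under eq_bigr => m _.
  rewrite -cosN opprD -mulNr -mulrNz opprK -pmulrn; over.
by rewrite (P k.+1) ?cosN //; move: H; rewrite abszN.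
Qed.

Lemma sum_sin_grid (a : int) (b : R) : (`|a| < n)%N ->
  \sum_(m < n) sin (a%:~R * grid m + b) = (a == 0)%:R * n%:R * sin b.
Proof.
move=> an; rewrite -cosBpihalf -sum_cos_grid //.
by apply: eq_bigr => m _; rewrite addrA cosBpihalf.
Qed.

(** Integration by parts: a derivative has no constant term, and the grid is
    blind to the other frequencies below its size. *)
Lemma sum_grid_deriv D (g dg : R -> R) : trig_poly D g dg -> (D < n)%N ->
  \sum_(m < n) dg (grid m) = 0.
Proof.
move=> H Dn; elim: H => [j a jD|u g1 dg1 h dh _ H1 _ H2].
  rewrite sumrN -mulr_sumr; under eq_bigr do rewrite pmulrn.
  rewrite sum_sin_grid /=; last exact: leq_ltn_trans jD Dn.
  by case: j {jD} => [|j] /=; rewrite ?mulr0n ?mul0r ?mulr0 ?oppr0.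
by rewrite big_split /= -mulr_sumr H1 H2 mulr0 addr0.
Qed.

End Grid.
Arguments grid {R N} m.

(** * Bernstein's inequality and the weight sin^2 *)

Section Bernstein.
Context {R : realType}.
Variables (D N : nat).
Local Notation n := N.+1.
Local Notation grid := (@grid R N).

(** The squared modulus of the sum of e^(ipt) over p < D, which is D times the
    Fejer kernel. *)
Definition fejer (t : R) : R :=
  (\sum_(p < D) cos (p%:R * t)) ^+ 2 + (\sum_(p < D) sin (p%:R * t)) ^+ 2.

(** Samples of a kernel whose Fourier coefficients at the frequencies |j| <= D
    are those of differentiation. *)
Definition bernstein_weight (m : 'I_n) : R :=
  2 / n%:R * sin (D%:R * grid m) * fejer (grid m).

Lemma fejer_ge0 t : 0 <= fejer t.
Proof. by rewrite addr_ge0 ?sqr_ge0. Qed.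

Lemma fejerE t :
  fejer t = \sum_(p < D) \sum_(q < D) cos ((p%:Z - q%:Z)%:~R * t).
Proof.
rewrite /fejer !expr2 !mulr_suml -big_split /=; apply: eq_bigr => p _.
rewrite !mulr_sumr -big_split /=; apply: eq_bigr => q _.
by rewrite intrB mulrBl cosB !pmulrn.
Qed.

Lemma sum_pred1_ord (x : nat) :
  \sum_(q < D) ((q : nat) == x)%:R = (x < D)%:R :> R.
Proof.
case: ltnP => xD.
  rewrite (bigD1 (Ordinal xD)) //= eqxx big1 ?addr0 // => q.
  by rewrite -val_eqE /= => /negbTE ->.
by rewrite big1 // => q _; rewrite ltn_eqF // (leq_trans (ltn_ord q)).
Qed.

Lemma sum_diagonal (j : nat) : (j <= D)%N ->
  \sum_(p < D) \sum_(q < D) ((q : nat) == p + (D - j))%N%:R = j%:R :> R.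
Proof.
move=> jD; under eq_bigr do rewrite sum_pred1_ord.
under eq_bigr => p _.
  rewrite (_ : (p + (D - j) < D)%N = (p < j)%N); last by lia.
  over.
rewrite -[RHS](_ : \sum_(p < j) 1 = _); last by rewrite sumr_const card_ord.
rewrite (big_ord_widen _ (fun=> 1) jD) [RHS]big_mkcond.
by apply: eq_bigr => p _; case: ltnP.
Qed.

Hypothesis DN : (3 * D <= n)%N.

Lemma sum_norm_bernstein_weight :
  \sum_(m < n) `|bernstein_weight m| <= 2 * D%:R.
Proof.
apply: (@le_trans _ _ (\sum_(m < n) 2 / n%:R * fejer (grid m))).
  apply: ler_sum => m _; rewrite /bernstein_weight normrM.
  rewrite (ger0_norm (fejer_ge0 _)) ler_wpM2r ?fejer_ge0 // normrM.
  rewrite (ger0_norm (_ : 0 <= 2 / _)) ?divr_ge0 // ler_piMr ?divr_ge0 //.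
  by rewrite ler_norml sin_geN1 sin_le1.
rewrite -mulr_sumr; under eq_bigr do rewrite fejerE.
rewrite exchange_big /=.
rewrite (eq_bigr (fun=> n%:R)); last first.
  move=> p _; rewrite exchange_big /= (bigD1 p) //= [X in _ + X]big1 ?addr0.
    rewrite (eq_bigr (fun=> 1)); last first.
      by move=> m _; rewrite subrr mul0r cos0.
    by rewrite sumr_const card_ord.
  move=> q qp; under eq_bigr do rewrite -[_ * _]addr0.
  rewrite sum_cos_grid; last by move: (ltn_ord p) (ltn_ord q); lia.
  rewrite subr_eq0 (_ : (p%:Z == q%:Z) = (q == p)); last first.
    by rewrite eq_sym eqz_nat val_eqE.
  by rewrite (negbTE qp) mulr0n !mul0r.
rewrite sumr_const card_ord -[n%:R *+ D]mulr_natr mulrA.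
by rewrite divfK // pnatr_eq0.
Qed.

Let bernstein_term (j : nat) (k : int) (B : R) :
  (j <= D)%N -> (`|k| < D)%N ->
  \sum_(m < n) 2 * sin (D%:R * grid m) * cos (k%:~R * grid m)
     * cos (j%:R * grid m + B)
  = - (n%:R * sin B) / 2 *
    ((D%:Z - j%:Z + k == 0)%:R + (D%:Z - j%:Z - k == 0)%:R).
Proof.
move=> jD kD.
transitivity (2^-1 * (\sum_(m < n) sin ((D%:Z + j%:Z + k)%:~R * grid m + B)
  + \sum_(m < n) sin ((D%:Z + j%:Z - k)%:~R * grid m + B)
  + \sum_(m < n) sin ((D%:Z - j%:Z + k)%:~R * grid m + - B)
  + \sum_(m < n) sin ((D%:Z - j%:Z - k)%:~R * grid m + - B))).
  rewrite -!big_split mulr_sumr; apply: eq_bigr => m _ /=.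
  rewrite !intrD !intrN -!pmulrn.
  set x := D%:R * grid m; set z := j%:R * grid m + B; set y := k%:~R * grid m.
  rewrite (_ : (D%:R + j%:R + k%:~R) * grid m + B = (x + z) + y); last first.
    by rewrite /x /y /z; ring.
  rewrite (_ : (D%:R + j%:R - k%:~R) * grid m + B = (x + z) - y); last first.
    by rewrite /x /y /z; ring.
  rewrite (_ : (D%:R - j%:R + k%:~R) * grid m - B = (x - z) + y); last first.
    by rewrite /x /y /z; ring.
  rewrite (_ : (D%:R - j%:R - k%:~R) * grid m - B = (x - z) - y); last first.
    by rewrite /x /y /z; ring.
  rewrite (sinD (x + z)) (sinB (x + z)) (sinD (x - z)) (sinB (x - z)).
  by rewrite (sinD x) (sinB x); field.
rewrite !sum_sin_grid; [|lia..].
rewrite (_ : (D%:Z + j%:Z + k == 0) = false); last by lia.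
rewrite (_ : (D%:Z + j%:Z - k == 0) = false); last by lia.
by rewrite mulr0n sinN; field.
Qed.

(** Differentiation in degree at most D is a finite combination of rotations.
    At the frequency j the kernel counts the pairs p, q < D with q - p = D - j,
    and there are j of them; a grid of 3 D points keeps the other products of
    frequencies from being mistaken for constants. *)
Lemma bernstein_formula g dg : trig_poly D g dg ->
  forall t, dg t = \sum_(m < n) bernstein_weight m * g (t + grid m).
Proof.
elim=> [j a jD|u g1 dg1 h dh _ H1 _ H2] t; last first.
  rewrite H1 H2 mulr_sumr -big_split; apply: eq_bigr => m _ /=; ring.
set B := j%:R * t + a.
transitivity (n%:R^-1 * \sum_(p < D) \sum_(q < D) \sum_(m < n)
    2 * sin (D%:R * grid m) * cos ((p%:Z - q%:Z)%:~R * grid m)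
     * cos (j%:R * grid m + B)); last first.
  under eq_bigr do rewrite exchange_big /=.
  rewrite exchange_big mulr_sumr; apply: eq_bigr => m _ /=.
  rewrite /bernstein_weight fejerE.
  rewrite (_ : j%:R * (t + grid m) + a = j%:R * grid m + B); last first.
    by rewrite /B; ring.
  set c := n%:R^-1; set z := cos (j%:R * _ + B).
  rewrite [LHS]mulr_sumr mulr_sumr mulr_suml; apply: eq_bigr => p _.
  by rewrite [LHS]mulr_sumr mulr_sumr mulr_suml; apply: eq_bigr => q _; ring.
rewrite (eq_bigr (fun p : 'I_D => \sum_(q < D) (- (n%:R * sin B) / 2 *
    (((q : nat) == p + (D - j))%N%:R + ((p : nat) == q + (D - j))%N%:R)))).
  rewrite (eq_bigr (fun p : 'I_D => (- (n%:R * sin B) / 2) *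
     (\sum_(q < D) ((q : nat) == p + (D - j))%N%:R +
      \sum_(q < D) ((p : nat) == q + (D - j))%N%:R))).
    rewrite -mulr_sumr big_split /= sum_diagonal // exchange_big /=.
    rewrite sum_diagonal //.
    have : n%:R != 0 :> R by rewrite pnatr_eq0.
    by move=> ?; field.
  by move=> p _; rewrite -mulr_sumr big_split.
move=> p _; apply: eq_bigr => q _; rewrite bernstein_term //; last first.
  by move: (ltn_ord p) (ltn_ord q); lia.
congr (_ * (_%:R + _%:R)); move: (ltn_ord p) (ltn_ord q); lia.
Qed.

Lemma bernstein_power g dg t p : trig_poly D g dg -> 
  `|dg t| ^+ p.+1 <=
  (2 * D%:R) ^+ p * \sum_(m < n) `|bernstein_weight m| * `|g (t + grid m)| ^+ p.+1.
Proof.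
move=> H; case: (posnP D) => D0.
  rewrite (_ : dg t = 0).
    rewrite normr0 expr0n mulr_ge0 ?exprn_ge0 ?mulr_ge0 //.
    by apply: sumr_ge0 => m _; rewrite mulr_ge0 ?exprn_ge0.
  rewrite (bernstein_formula H) big1 // => m _.
  by rewrite /bernstein_weight D0 mul0r sin0 mulr0 !mul0r.
apply: (@le_trans _ _ ((\sum_(m < n) `|bernstein_weight m| * `|g (t + grid m)|) ^+ p.+1)).
  rewrite lerXn2r ?nnegrE ?sumr_ge0 //.
  rewrite (bernstein_formula H); apply: le_trans (ler_norm_sum _ _ _) _.
  by apply: ler_sum => m _; rewrite normrM.
apply: expr_sum_le => //; last exact: sum_norm_bernstein_weight.
by rewrite mulr_gt0 // ltr0n.
Qed.

Lemma bernstein_grid_l2 g dg : trig_poly D g dg ->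
  \sum_(m < n) dg (grid m) ^+ 2 <= (2 * D%:R) ^+ 2 * \sum_(m < n) g (grid m) ^+ 2.
Proof.
move=> H; apply: (@le_trans _ _ (\sum_(m < n)
    (2 * D%:R) * \sum_(l < n) `|bernstein_weight l| * g (grid m + grid l) ^+ 2)).
  apply: ler_sum => m _; have := bernstein_power (grid m) 1 H.
  by rewrite expr1 real_normK ?num_real //; under eq_bigr do rewrite real_normK ?num_real //.
rewrite -mulr_sumr exchange_big /= expr2 -[leRHS]mulrA ler_wpM2l ?mulr_ge0 //.
apply: (@le_trans _ _ (\sum_(l < n) `|bernstein_weight l| * \sum_(m < n) g (grid m) ^+ 2)).
  apply: ler_sum => l _; rewrite -mulr_sumr.
  rewrite (@sum_grid_shift _ _ (fun x => g x ^+ 2)) // => x.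
  by rewrite (trig_poly_periodic H).
rewrite -mulr_suml ler_wpM2r ?sum_norm_bernstein_weight //.
by apply: sumr_ge0 => m _; rewrite sqr_ge0.
Qed.

(** The mean of the derivative of sin cos g^2 vanishes, so the sum A of g^2 is
    twice the sum of sin^2 g^2 minus twice that of (sin g) (cos g'). Bernstein's
    inequality for g' lets half of A absorb the last term. *)
Lemma sin2_weight_removal g dg : (2 * D + 2 < n)%N -> trig_poly D g dg ->
  \sum_(m < n) g (grid m) ^+ 2 <=
  (4 * D.+1%:R) ^+ 2 * \sum_(m < n) sin (grid m) ^+ 2 * g (grid m) ^+ 2.
Proof.
move=> Dn H.
have P := trig_polyM (trig_polyM trig_poly_sin1 (trig_poly_cos1 0)) (trig_polyM H H).
have D2 : (1 + 1 + (D + D) < n)%N by lia.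
have {P D2} := sum_grid_deriv P D2.
set A := \sum_(m < n) g (grid m) ^+ 2.
set B := \sum_(m < n) sin (grid m) ^+ 2 * g (grid m) ^+ 2.
set E := \sum_(m < n) dg (grid m) ^+ 2.
have HE : E <= (2 * D%:R) ^+ 2 * A := bernstein_grid_l2 H.
have B0 : 0 <= B by apply: sumr_ge0 => m _; rewrite mulr_ge0 ?sqr_ge0.
have A0 : 0 <= A by apply: sumr_ge0 => m _; rewrite ?sqr_ge0.
(* The weight in 2 u v <= c u^2 + v^2 / c. The choice 8 D^2 would make E / c
   at most A / 2; adding 1 keeps c positive when D = 0. *)
pose c : R := 8 * D%:R ^+ 2 + 1.
have c0 : 0 < c by rewrite ltr_wpDl // mulr_ge0 ?sqr_ge0.
move=> Z.
have {}Z : A - 2 * B = - \sum_(m < n) (2 * (sin (grid m) * g (grid m)) * (cos (grid m) * dg (grid m))).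
  apply/eqP; rewrite -addr_eq0 /A /B mulr_sumr -sumrB -big_split /=.
  apply/eqP; rewrite -[RHS]Z; apply: eq_bigr => m _; rewrite addr0.
  have C : cos (grid m) ^+ 2 = 1 - sin (grid m) ^+ 2.
    by rewrite -(cos2Dsin2 (grid m)) addrK.
  by rewrite mulrN -!expr2 C; ring.
have Y : A - 2 * B <= c * B + c^-1 * E.
  rewrite Z -sumrN /B /E !mulr_sumr -big_split; apply: ler_sum => m _ /=.
  set x := sin _ * _; set y := cos _ * _.
  have y2 : y ^+ 2 <= dg (grid m) ^+ 2.
    by rewrite /y exprMn ler_piMl ?sqr_ge0 // -(cos2Dsin2 (grid m)) lerDl sqr_ge0.
  rewrite -exprMn -/x.
  apply: (@le_trans _ _ (c * x ^+ 2 + c^-1 * y ^+ 2)); last first.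
    by rewrite lerD2l ler_wpM2l // invr_ge0 ltW.
  rewrite -subr_ge0 (_ : _ - _ = c * (x + c^-1 * y) ^+ 2).
    by rewrite mulr_ge0 ?sqr_ge0 // ltW.
  by field; rewrite gt_eqF.
have cE : c^-1 * E <= A / 2.
  apply: (@le_trans _ _ (c^-1 * ((2 * D%:R) ^+ 2 * A))).
    by rewrite ler_wpM2l // invr_ge0 ltW.
  rewrite mulrC ler_pdivrMr // /c -subr_ge0.
  by rewrite (_ : _ - _ = A / 2) ?divr_ge0 //; field.
have : A <= 4 * B + 2 * (c * B).
  by move: (c * B) (c^-1 * E) Y cE => u v Y cE; clear -Y cE; lra.
move=> /le_trans; apply; rewrite /c -subr_ge0 -natr1.
rewrite (_ : _ - _ = (32 * D%:R + 10) * B); last by ring.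
by rewrite mulr_ge0 // addr_ge0 // mulr_ge0.
Qed.

End Bernstein.

(** * Multivariate polynomials along curves *)

Section MpolyCurve.
Context {R : realType} {n : nat}.
Implicit Types (f p : mpoly n R).

(** The lower degree of the derivative is what allows the factor 4 k d, instead
    of 4 (k d + 1), in [torus_weight_removal]. *)
Lemma msize_mderiv_le i f d : (msize f <= d.+1)%N -> (msize (mderiv i f) <= d.-1.+1)%N.
Proof.
move=> fd; rewrite msizeE; apply/bigmax_leqP_seq => m mf _.
have : mnm_add m (mnm1 i) \in msupp f.
  move: mf; rewrite !mcoeff_msupp mcoeff_deriv; apply: contraNN => /eqP ->.
  by rewrite mul0rn.
move=> /msize_mdeg_lt; rewrite mdegD mdeg1; lia.
Qed.

Variables (x dx : 'I_n -> R -> R).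
Hypothesis x_trig : forall i, trig_poly 1 (x i) (dx i).

Let along D p := trig_poly D (fun t => meval (x ^~ t) p)
  (fun t => \sum_i meval (x ^~ t) (mderiv i p) * dx i t).

Let along_le D E p : (D <= E)%N -> along D p -> along E p.
Proof. exact: trig_poly_le. Qed.

Let alongM D E p q : along D p -> along E q -> along (D + E) (p * q).
Proof.
move=> Hp Hq; apply: (trig_poly_ext (trig_polyM Hp Hq)) => t.
  by rewrite mevalM.
rewrite mulr_suml mulr_sumr -big_split; apply: eq_bigr => i _ /=.
by rewrite mderivM mevalD !mevalM; ring.
Qed.

Let along_lin D c p q : along D p -> along D q -> along D (c *: p + q).
Proof.
move=> Hp Hq; apply: (trig_poly_ext (TrigLin c Hp Hq)) => t.
  by rewrite mevalD mevalZ.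
rewrite mulr_sumr -big_split; apply: eq_bigr => i _ /=.
by rewrite mderivD mderivZ mevalD mevalZ; ring.
Qed.

Let along1 : along 0 1.
Proof.
apply: (trig_poly_ext (trig_poly_cst 0 1)) => t; first by rewrite meval1.
by rewrite big1 // => i _; rewrite -mpolyC1 mderivC meval0 mul0r.
Qed.

Let along0 : along 0 0.
Proof.
apply: (trig_poly_ext (trig_poly_cst 0 0)) => t; first by rewrite meval0.
by rewrite big1 // => i _; rewrite mderiv0 meval0 mul0r.
Qed.

Let alongX i : along 1 (mpolyX R (mnm1 i)).
Proof.
apply: (trig_poly_ext (x_trig i)) => t; first by rewrite mevalXU.
rewrite (bigD1 i) //= big1 ?addr0 => [|j ji].
  rewrite mderivX mnmE eqxx scale1r; set m := mnm_sub _ _.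
  rewrite (_ : m = mnm0) ?mpolyX0 ?meval1 ?mul1r //.
  by apply/mnmP => l; rewrite !mnmE subnn.
by rewrite mderivX mnmE eq_sym (negbTE ji) scale0r meval0 mul0r.
Qed.

(** Along a curve with coordinates of degree one, the degree is bounded by the
    total degree of f, regardless of the number of variables. *)
Lemma trig_poly_meval f D : (msize f <= D.+1)%N ->
  trig_poly D (fun t => meval (x ^~ t) f)
    (fun t => \sum_i meval (x ^~ t) (mderiv i f) * dx i t).
Proof.
move=> fD; rewrite -/(along D f) [f]mpolyE big_seq.
apply: (big_ind (along D)); [exact: along_le along0| |].
  by move=> p q Hp Hq; rewrite -[p]scale1r; apply: along_lin.
move=> m /msize_mdeg_lt mf; rewrite -[_ *: _]addr0.
apply: along_lin; last exact: along_le along0.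
have {fD}mD : (mdeg m <= D)%N by rewrite -ltnS (leq_trans mf).
apply: along_le mD _; rewrite mpolyXE_id mdegE.
apply: (big_ind2 (fun p k => along k p)) => //.
  by move=> p k q l Hp Hq; apply: alongM.
move=> i _; elim: (m i) => [|k IH]; first by rewrite expr0.
by rewrite exprS -add1n; apply: alongM.
Qed.

End MpolyCurve.

(** * Markov's inequality on a product of circles *)

Section Torus.
Context {R : realType} {n : nat}.
Variable N : nat.
Local Notation torus := {ffun 'I_n -> 'I_N.+1}.
Implicit Types (p q : torus).

Lemma grid_opp (g : R -> R) (m : 'I_N.+1) : periodic g (pi *+ 2) ->
  g (grid (- m)) = g (- grid m).
Proof.
move=> pg; pose h (t : R) := g (t - grid m).
have ph : periodic h (pi *+ 2) by move=> t; rewrite /h addrAC pg.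
have := gridD 0 (- m) m ph; rewrite /h addNr !add0r addrK => <-.
by rewrite [grid 0]/grid mulr0 mul0r add0r.
Qed.

Lemma sum_torus_shift (F : torus -> R) q : \sum_(p : torus) F (p + q) = \sum_(p : torus) F p.
Proof. by rewrite [RHS](reindex_inj (addIr q)). Qed.

Definition torus_set (i : 'I_n) (m : 'I_N.+1) p : torus :=
  [ffun l => if l == i then m else p l].

(** Averaging over a single angle first, by translation invariance. *)
Lemma sum_torus_set i (F : torus -> R) :
  \sum_(p : torus) \sum_m F (torus_set i m p) = N.+1%:R * \sum_(p : torus) F p.
Proof.
transitivity (\sum_(p : torus) \sum_m F (p + torus_set i m 0)).
  apply: eq_bigr => p _; rewrite (reindex_inj (addrI (p i))).
  apply: eq_bigr => m _; congr F; apply/ffunP => l; rewrite !ffunE.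
  by case: eqP => [->//|_]; rewrite addr0.
rewrite exchange_big /=; under eq_bigr do rewrite sum_torus_shift.
by rewrite sumr_const card_ord mulr_natl.
Qed.

Definition torus_flip (i : 'I_n) p : torus :=
  [ffun l => if l == i then - p l else p l].

Lemma torus_flipK i : involutive (torus_flip i).
Proof. by move=> p; apply/ffunP => l; rewrite !ffunE; case: eqP => // _; rewrite opprK. Qed.

Variables (c r : 'I_n -> R).

Definition torus_point p (i : 'I_n) : R := c i + r i * cos (grid (p i)).

Lemma torus_point_flip i p : torus_point (torus_flip i p) =1 torus_point p.
Proof.
move=> l; rewrite /torus_point ffunE; case: eqP => // _.
by rewrite (grid_opp _ (@cosD2pi R)) cosN.
Qed.

Variables (f : mpoly n R).
Let F p := meval (torus_point p) f.
Let g i p := meval (torus_point p) (mderiv i f).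

(** Turning all the angles by the same t makes f a trigonometric polynomial in
    t of degree at most d, whose derivative at 0 is, up to sign, the sum on the
    left. The dimension disappears here, because the rotations by grid angles
    preserve the sum over the torus. *)
Lemma torus_bernstein d k : (3 * d <= N.+1)%N -> (msize f <= d.+1)%N ->
  \sum_(p : torus) (\sum_i r i * sin (grid (p i)) * g i p) ^+ k.+1.*2 <=
  (2 * d%:R) ^+ k.+1.*2 * \sum_(p : torus) F p ^+ k.+1.*2.
Proof.
move=> dN fd.
have E2 (x : R) : `|x| ^+ k.+1.*2 = x ^+ k.+1.*2.
  by rewrite -normrX ger0_norm // exprn_even_ge0 // odd_double.
pose w m := `|@bernstein_weight R d N m|.
apply: (@le_trans _ _ (\sum_(p : torus) (2 * d%:R) ^+ k.*2.+1 *
    \sum_m w m * F (p + [ffun=> m]) ^+ k.+1.*2)).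
  apply: ler_sum => p _.
  pose x i (t : R) := c i + r i * cos (t + grid (p i)).
  pose dx i (t : R) := - (r i * sin (t + grid (p i))).
  have xt i : trig_poly 1 (x i) (dx i).
    apply: (trig_poly_ext (trig_polyD (trig_poly_cst 1 (c i))
      (trig_polyZ (r i) (trig_poly_cos1 (grid (p i)))))) => t //.
    by rewrite /dx add0r mulrN.
  have := @bernstein_power _ _ _ dN _ _ 0 k.*2.+1 (trig_poly_meval xt fd).
  rewrite -doubleS; under [X in _ <= _ * X]eq_bigr do rewrite E2 add0r.
  rewrite E2 => H; apply: le_trans (le_trans H _).
    rewrite le_eqVlt; apply/orP; left; apply/eqP.
    rewrite -[LHS]E2 -[RHS]E2 -normrN -sumrN; congr (`|_| ^+ _).
    apply: eq_bigr => i _; rewrite /dx add0r mulrN mulrC; congr (- (_ * _)).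
    by apply: meval_eq => l; rewrite /x add0r.
  rewrite le_eqVlt; apply/orP; left; apply/eqP; congr (_ * _).
  apply: eq_bigr => m _; congr (_ * _ ^+ _); apply: meval_eq => l.
  rewrite /x /torus_point !ffunE -{1}[grid (p l + m)]add0r.
  by rewrite (gridD _ _ _ (@cosD2pi R)) add0r (addrC (grid m)).
rewrite -mulr_sumr exchange_big /=.
rewrite [leLHS](_ : _ = (2 * d%:R) ^+ k.*2.+1 *
    ((\sum_m w m) * \sum_(p : torus) F p ^+ k.+1.*2)); last first.
  congr (_ * _); rewrite mulr_suml; apply: eq_bigr => m _.
  by rewrite -mulr_sumr (sum_torus_shift (fun p => F p ^+ _)).
rewrite doubleS [in leRHS]exprSr -[leRHS]mulrA.
rewrite ler_wpM2l ?exprn_ge0 ?mulr_ge0 // ler_wpM2r ?sum_norm_bernstein_weight //.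
by apply: sumr_ge0 => p _; rewrite exprn_even_ge0 //= odd_double.
Qed.

(** Reflecting one angle changes the sign of one summand and leaves the squares
    of all of them unchanged. Hence the cross terms in the square of the sum
    vanish on average, even against powers of the sum of the squares, and the
    claim follows by convexity. *)
Lemma torus_square_function k :
  \sum_(p : torus) (\sum_i r i ^+ 2 * sin (grid (p i)) ^+ 2 * g i p ^+ 2) ^+ k.+1 <=
  \sum_(p : torus) (\sum_i r i * sin (grid (p i)) * g i p) ^+ k.+1.*2.
Proof.
pose a i p := r i * sin (grid (p i)) * g i p.
pose S p := \sum_i a i p ^+ 2.
pose Y p := (\sum_i a i p) ^+ 2.
have S0 p : 0 <= S p by apply: sumr_ge0 => i _; exact: sqr_ge0.
have Y0 p : 0 <= Y p by exact: sqr_ge0.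
rewrite (eq_bigr (fun p => S p ^+ k.+1)); last first.
  by move=> p _; congr (_ ^+ _); apply: eq_bigr => i _; rewrite !exprMn.
rewrite [leRHS](eq_bigr (fun p => Y p ^+ k.+1)); last first.
  by move=> p _; rewrite -exprM mul2n.
have a_flip i j p : a j (torus_flip i p) = if j == i then - a j p else a j p.
  rewrite /a /g (meval_eq _ (torus_point_flip i p)) ffunE.
  by case: eqP => // _; rewrite (grid_opp _ (@sinD2pi R)) sinN; ring.
have S_flip i p : S (torus_flip i p) = S p.
  by apply: eq_bigr => j _; rewrite a_flip; case: eqP => // _; rewrite sqrrN.
have cross i j : j != i -> \sum_(p : torus) S p ^+ k * (a i p * a j p) = 0.
  move=> ji; apply/eqP; rewrite -eqNr -sumrN; apply/eqP.
  rewrite [RHS](reindex_inj (inv_inj (torus_flipK i))); apply: eq_bigr => p _.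
  by rewrite S_flip !a_flip eqxx (negbTE ji); ring.
have SY : \sum_(p : torus) S p ^+ k * Y p = \sum_(p : torus) S p ^+ k.+1.
  rewrite (eq_bigr (fun p => \sum_i \sum_j S p ^+ k * (a i p * a j p))); last first.
    move=> p _; rewrite /Y expr2 mulr_suml mulr_sumr; apply: eq_bigr => i _.
    by rewrite !mulr_sumr; apply: eq_bigr => j _.
  rewrite exchange_big /= (eq_bigr (fun i => \sum_(p : torus) S p ^+ k * a i p ^+ 2)).
    rewrite exchange_big; apply: eq_bigr => p _ /=.
    by rewrite -mulr_sumr exprSr.
  move=> i _; rewrite exchange_big (bigD1 i) //= [X in _ + X]big1 ?addr0 => [|j ji].
    by apply: eq_bigr => p _; rewrite expr2.
  exact: cross.
have : \sum_(p : torus) k.+1%:R * S p ^+ k * Y p <= \sum_(p : torus) (Y p ^+ k.+1 + k%:R * S p ^+ k.+1).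
  by apply: ler_sum => p _; exact: young_expr.
have -> : \sum_(p : torus) k.+1%:R * S p ^+ k * Y p =
          k.+1%:R * \sum_(p : torus) S p ^+ k * Y p.
  by rewrite mulr_sumr; apply: eq_bigr => p _; rewrite mulrA.
rewrite SY big_split /= -mulr_sumr -natr1.
by rewrite mulrDl mul1r addrC lerD2l.
Qed.

(** With Phi the sum of the r_i^2 g_i^2, each g_i^2 Phi^k is a sum of squares
    of functions that are trigonometric polynomials of degree (k + 1)(d - 1) in
    the i-th angle, so [sin2_weight_removal] applies to it in that angle. This
    bounds the sum of Phi^(k + 1) by that of K Psi Phi^k, where Psi carries the
    weights, and [young_expr] separates the two factors. *)
Lemma torus_weight_removal d k :
  (0 < d)%N -> (3 * (k.+1 * d) + 3 <= N.+1)%N -> (msize f <= d.+1)%N ->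
  \sum_(p : torus) (\sum_i r i ^+ 2 * g i p ^+ 2) ^+ k.+1 <=
  (4 * (k.+1 * d)%:R) ^+ k.+1.*2 *
    \sum_(p : torus) (\sum_i r i ^+ 2 * sin (grid (p i)) ^+ 2 * g i p ^+ 2) ^+ k.+1.
Proof.
move=> d0 dN fd.
pose Phi p := \sum_i r i ^+ 2 * g i p ^+ 2.
pose Psi p := \sum_i r i ^+ 2 * sin (grid (p i)) ^+ 2 * g i p ^+ 2.
pose K : R := (4 * (k.+1 * d)%:R) ^+ 2.
have K0 : 0 <= K by exact: sqr_ge0.
have Phi0 p : 0 <= Phi p by apply: sumr_ge0 => i _; rewrite mulr_ge0 ?sqr_ge0.
have Psi0 p : 0 <= Psi p by apply: sumr_ge0 => i _; rewrite mulr_ge0 ?sqr_ge0 // mulr_ge0 ?sqr_ge0.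
have PhiX p : Phi p ^+ k =
    \sum_(s : {ffun 'I_k -> 'I_n}) (\prod_j (r (s j) * g (s j) p)) ^+ 2.
  rewrite /Phi -[in LHS](card_ord k) -prodr_const bigA_distr_bigA /=.
  apply: eq_bigr => s _; rewrite -prodrXl; apply: eq_bigr => j _.
  by rewrite exprMn.
have coord i : \sum_(p : torus) g i p ^+ 2 * Phi p ^+ k <=
    K * \sum_(p : torus) sin (grid (p i)) ^+ 2 * (g i p ^+ 2 * Phi p ^+ k).
  pose G (s : {ffun 'I_k -> 'I_n}) p := g i p * \prod_j (r (s j) * g (s j) p).
  have GE p : g i p ^+ 2 * Phi p ^+ k = \sum_s G s p ^+ 2.
    by rewrite PhiX mulr_sumr; apply: eq_bigr => s _; rewrite exprMn.
  under eq_bigr do rewrite GE.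
  under [in leRHS]eq_bigr do rewrite GE mulr_sumr.
  rewrite exchange_big [in leRHS]exchange_big mulr_sumr; apply: ler_sum => s _ /=.
  rewrite -(@ler_pM2l _ N.+1%:R) ?ltr0n // mulrCA.
  rewrite -(sum_torus_set i) -(sum_torus_set i) mulr_sumr.
  apply: ler_sum => p _.
  pose x l (t : R) := if l == i then c i + r i * cos (t + 0) else torus_point p l.
  pose dx l (t : R) := if l == i then 0 + r i * - sin (t + 0) else 0.
  have xt l : trig_poly 1 (x l) (dx l).
    rewrite /x /dx; case: eqP => _; last exact: trig_poly_cst.
    apply: trig_polyD; first exact: trig_poly_cst.
    by apply: trig_polyZ; exact: trig_poly_cos1.
  have xE m l : torus_point (torus_set i m p) l = x l (grid m).
    by rewrite /x /torus_point ffunE; case: eqP => // ->; rewrite addr0.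
  have gt l := trig_poly_meval xt (msize_mderiv_le l fd).
  have [dG HG] : exists dG, trig_poly (k.+1 * d.-1)
      (fun t => meval (x ^~ t) (mderiv i f) *
        \prod_j (r (s j) * meval (x ^~ t) (mderiv (s j) f))) dG.
    have [dH HH] := trig_poly_prod (fun j => trig_polyZ (r (s j)) (gt (s j))).
    by rewrite mulSn; eexists; exact: (trig_polyM (gt i) HH).
  have GE' m : G s (torus_set i m p) = meval (x ^~ (grid m)) (mderiv i f) *
        \prod_j (r (s j) * meval (x ^~ (grid m)) (mderiv (s j) f)).
    rewrite /G /g (meval_eq _ (xE m)); congr (_ * _).
    by apply: eq_bigr => j _; rewrite (meval_eq _ (xE m)).
  under eq_bigr do rewrite GE'.
  under [in leRHS]eq_bigr do rewrite GE' ffunE eqxx.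
  have D1 : (3 * (k.+1 * d.-1) <= N.+1)%N.
    by apply: leq_trans dN; rewrite -[leqLHS]addn0 leq_add // !leq_mul // leq_pred.
  have D2 : (2 * (k.+1 * d.-1) + 2 < N.+1)%N.
    apply: leq_trans dN; have : (k.+1 * d.-1 <= k.+1 * d)%N by rewrite leq_mul // leq_pred.
    lia.
  apply: le_trans (sin2_weight_removal D1 D2 HG) _.
  rewrite ler_wpM2r //.
    by apply: sumr_ge0 => m _; rewrite mulr_ge0 ?sqr_ge0.
  rewrite /K lerXn2r ?nnegrE ?mulr_ge0 // ler_wpM2l // ler_nat.
  by rewrite ltn_pmul2l // ltn_predL.
have main : \sum_(p : torus) Phi p ^+ k.+1 <= \sum_(p : torus) (K * Psi p) * Phi p ^+ k.
  rewrite (eq_bigr (fun p => \sum_i r i ^+ 2 * (g i p ^+ 2 * Phi p ^+ k))); last first.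
    by move=> p _; rewrite exprS [X in X * _ = _]/Phi mulr_suml; apply: eq_bigr => i _; rewrite -mulrA.
  rewrite [leRHS](eq_bigr (fun p => \sum_i r i ^+ 2 *
     (K * (sin (grid (p i)) ^+ 2 * (g i p ^+ 2 * Phi p ^+ k))))); last first.
    by move=> p _; rewrite /Psi mulr_sumr mulr_suml; apply: eq_bigr => i _; ring.
  rewrite exchange_big [leRHS]exchange_big; apply: ler_sum => i _ /=.
  by rewrite -!mulr_sumr ler_wpM2l ?sqr_ge0.
have : \sum_(p : torus) k.+1%:R * Phi p ^+ k * (K * Psi p) <=
       \sum_(p : torus) ((K * Psi p) ^+ k.+1 + k%:R * Phi p ^+ k.+1).
  by apply: ler_sum => p _; apply: young_expr; rewrite ?mulr_ge0.
have -> : \sum_(p : torus) k.+1%:R * Phi p ^+ k * (K * Psi p) =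
          k.+1%:R * \sum_(p : torus) (K * Psi p) * Phi p ^+ k.
  by rewrite mulr_sumr; apply: eq_bigr => p _; ring.
move=> /(le_trans (ler_wpM2l (ler0n _ k.+1) main)).
rewrite big_split /= -mulr_sumr -natr1 mulrDl mul1r [leRHS]addrC lerD2l.
move=> /le_trans; apply; rewrite mulr_sumr; apply: ler_sum => p _.
by rewrite exprMn /K -exprM mul2n.
Qed.

End Torus.

Section TorusMarkov.
Context {R : realType} {n : nat}.

Lemma torus_markov N (c r : 'I_n -> R) (f : mpoly n R) d k :
  (0 < d)%N -> (3 * (k.+1 * d) + 3 <= N.+1)%N -> (msize f <= d.+1)%N ->
  \sum_(p : {ffun 'I_n -> 'I_N.+1})
     (\sum_i r i ^+ 2 * meval (torus_point c r p) (mderiv i f) ^+ 2) ^+ k.+1 <=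
  (8 * k.+1%:R * d%:R ^+ 2) ^+ k.+1.*2 *
  \sum_(p : {ffun 'I_n -> 'I_N.+1}) meval (torus_point c r p) f ^+ k.+1.*2.
Proof.
move=> d0 dN fd; apply: le_trans (torus_weight_removal c r d0 dN fd) _.
rewrite (_ : 8 * k.+1%:R * d%:R ^+ 2 = (4 * (k.+1 * d)%:R) * (2 * d%:R)); last first.
  by rewrite natrM; ring.
rewrite [X in _ <= X * _]exprMn -[leRHS]mulrA ler_wpM2l ?exprn_ge0 ?mulr_ge0 //.
apply: le_trans (torus_square_function N c r f k) _.
apply: torus_bernstein => //; apply: leq_trans dN.
by rewrite mulSn mulnDr -addnA leq_addr.
Qed.

End TorusMarkov.

(** * Integrals of univariate polynomials *)

Section PolyIntegral.
Context {R : realType}.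
Local Notation mu := (@lebesgue_measure R).
Implicit Types (a b : R) (q : {poly R}).

Definition poly_prim q : {poly R} :=
  \poly_(i < (size q).+1) (q`_i.-1 / i%:R).

Lemma deriv_poly_prim q : (poly_prim q)^`() = q.
Proof.
apply/polyP => i; rewrite coef_deriv coef_poly ltnS /=.
case: ltnP => [_|qi]; last by rewrite mul0rn nth_default.
by rewrite -[_ *+ _]mulr_natr divfK // pnatr_eq0.
Qed.

Definition poly_int a b q : R := (poly_prim q).[b] - (poly_prim q).[a].

Lemma poly_intE a b Q : poly_int a b Q^`() = Q.[b] - Q.[a].
Proof.
suff [c E] : exists c, poly_prim (Q^`()) = Q + c%:P.
  by rewrite /poly_int E !hornerE; ring.
exists ((poly_prim Q^`())`_0 - Q`_0); apply/polyP => -[|i].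
  by rewrite coefD coefC /= addrC subrK.
rewrite coefD coefC /= addr0; apply: (@mulfI _ i.+1%:R); first by rewrite pnatr_eq0.
by rewrite !mulr_natl -!coef_deriv deriv_poly_prim.
Qed.

Lemma poly_int_lin a b u p q :
  poly_int a b (u *: p + q) = u * poly_int a b p + poly_int a b q.
Proof.
rewrite -{1}(deriv_poly_prim p) -{1}(deriv_poly_prim q) -derivZ -derivD poly_intE.
by rewrite !hornerD !hornerZ /poly_int; ring.
Qed.

Lemma poly_int0 a b : poly_int a b 0 = 0.
Proof. by rewrite -deriv0 poly_intE !horner0 subrr. Qed.

Lemma poly_intD a b p q : poly_int a b (p + q) = poly_int a b p + poly_int a b q.
Proof. by rewrite -[p in LHS]scale1r poly_int_lin mul1r. Qed.

Lemma poly_intZ a b u p : poly_int a b (u *: p) = u * poly_int a b p.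
Proof. by rewrite -[_ *: _]addr0 poly_int_lin poly_int0 addr0. Qed.

Lemma poly_intB a b p q : poly_int a b (p - q) = poly_int a b p - poly_int a b q.
Proof. by rewrite addrC -scaleN1r poly_int_lin; ring. Qed.

Lemma poly_int_sum a b I (s : seq I) (P : pred I) (F : I -> {poly R}) :
  poly_int a b (\sum_(i <- s | P i) F i) = \sum_(i <- s | P i) poly_int a b (F i).
Proof. by apply: big_morph => [p q|]; [exact: poly_intD|exact: poly_int0]. Qed.

Lemma integral_poly_int a b q : a <= b ->
  (\int[mu]_(x in `[a, b]) (q.[x])%:E = (poly_int a b q)%:E)%E.
Proof.
rewrite le_eqVlt => /predU1P[->|ab].
  by rewrite set_itv1 integral_set1 /poly_int subrr.
rewrite (@continuous_FTC2 _ (horner q) (horner (poly_prim q))) //.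
- by apply: continuous_subspaceT => x; exact: continuous_horner.
- split.
  + by move=> x _; exact: derivable_horner.
  + by apply: cvg_at_right_filter; exact: continuous_horner.
  + by apply: cvg_at_left_filter; exact: continuous_horner.
- by move=> x _; rewrite -derivE deriv_poly_prim.
Qed.

Lemma poly_int_ge0 a b q : a <= b ->
  (forall x, a <= x <= b -> 0 <= q.[x]) -> 0 <= poly_int a b q.
Proof.
move=> ab q0; rewrite -lee_fin -integral_poly_int //; apply: integral_ge0 => x /=.
by rewrite in_itv /= lee_fin => /q0.
Qed.

End PolyIntegral.

(** * Archimedes' theorem for polynomials *)

Section CircleAverage.
Context {R : realType}.
Variable N : nat.

Definition circle_mean (F : R -> R) (c r : R) : R :=
  N.+1%:R^-1 * \sum_(j < N.+1) F (c + r * cos (grid j)).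

Definition cos_moment (m : nat) : R :=
  N.+1%:R^-1 * \sum_(j < N.+1) cos (@grid R N j) ^+ m.

Lemma cos_moment0 : cos_moment 0 = 1.
Proof.
rewrite /cos_moment; under eq_bigr do rewrite expr0.
by rewrite sumr_const card_ord mulVf // pnatr_eq0.
Qed.

Lemma trig_poly_cosX m : trig_poly m (fun t : R => cos t ^+ m)
   (fun t => - (m%:R * cos t ^+ m.-1 * sin t)).
Proof.
elim: m => [|m IH].
  by apply: (trig_poly_ext (trig_poly_cst 0 1)) => t; rewrite ?expr0 // !mul0r oppr0.
apply: (trig_poly_ext (trig_polyM (trig_poly_cos1 0) IH)) => t.
  by rewrite addr0 exprS.
rewrite addr0 /= -natr1; case: m {IH} => [|m]; first by rewrite /= expr0; ring.
by rewrite /= exprS; ring.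
Qed.

(** Wallis' recurrence. *)
Lemma cos_momentSS m : (m.+2 < N.+1)%N ->
  m.+2%:R * cos_moment m.+2 = m.+1%:R * cos_moment m.
Proof.
move=> mN; have T := trig_polyM trig_poly_sin1 (trig_poly_cosX m.+1).
have := sum_grid_deriv T mN; rewrite /cos_moment => Z.
rewrite mulrCA [RHS]mulrCA; congr (_ * _); apply/eqP; rewrite -subr_eq0.
rewrite !mulr_sumr -sumrB; apply/eqP; rewrite -[RHS]Z; apply: eq_bigr => j _ /=.
have S : sin (@grid R N j) ^+ 2 = 1 - cos (@grid R N j) ^+ 2.
  by rewrite -(cos2Dsin2 (grid j)); ring.
rewrite [X in _ = _ + X](_ : _ =
  - (m.+1%:R * cos (grid j) ^+ m * sin (grid j) ^+ 2)); last by ring.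
by rewrite S -!natr1 !exprS; ring.
Qed.

Lemma cos_moment_odd m : odd m -> (m < N.+1)%N -> cos_moment m = 0.
Proof.
elim/ltn_ind: m => -[|[|m]] // IH mo mN.
  rewrite /cos_moment (sum_grid_deriv trig_poly_sin1) ?mulr0 //.
apply: (@mulfI _ m.+2%:R); first by rewrite pnatr_eq0.
rewrite cos_momentSS // IH ?mulr0 //; first by move: mo; rewrite /= negbK.
exact: ltn_trans mN.
Qed.

Variables (a b : R).
Let c := (a + b) / 2.
Let h := (b - a) / 2.
Let y : {poly R} := 'X - c%:P.
Let W : {poly R} := (h ^+ 2)%:P - y ^+ 2.
Local Notation I := (poly_int a b).

Let yb : y.[b] = h. Proof. by rewrite /y !hornerE /c /h; field. Qed.
Let ya : y.[a] = - h. Proof. by rewrite /y !hornerE /c /h; field. Qed.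

Let dy : y^`() = 1. Proof. by rewrite /y derivB derivX derivC subr0. Qed.

Let Wab x : W.[x] = (x - a) * (b - x).
Proof. by rewrite /W /y !hornerE /c /h; field. Qed.

Let dyX m : (y ^+ m.+1)^`() = m.+1%:R *: y ^+ m.
Proof. by rewrite deriv_exp dy mul1r scaler_nat. Qed.

Let dW : W^`() = - (2%:R *: y).
Proof. by rewrite /W derivB derivC sub0r dyX expr1. Qed.

Let int_y_odd m : odd m -> I (y ^+ m) = 0.
Proof.
move=> mo; rewrite -[y ^+ m](@scalerK _ _ m.+1%:R) ?unitfE ?pnatr_eq0 //.
rewrite -dyX poly_intZ poly_intE !horner_exp ya yb.
by rewrite exprNn -signr_odd /= mo /= expr0 mul1r subrr mulr0.
Qed.

Let int_ySS p : (2 * p + 3)%:R * I (y ^+ p.*2.+2) = (2 * p + 1)%:R * h ^+ 2 * I (y ^+ p.*2).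
Proof.
have : I ((y ^+ p.*2.+1 * W)^`()) = 0.
  by rewrite poly_intE !hornerM !Wab !subrr !(mulr0, mul0r) subrr.
have -> : (y ^+ p.*2.+1 * W)^`() =
    ((2 * p + 1)%:R * h ^+ 2) *: y ^+ p.*2 - (2 * p + 3)%:R *: y ^+ p.*2.+2.
  rewrite derivM dyX dW /W -!mul_polyC !polyCM !polyC_natr !exprS -mul2n.
  by rewrite -!natr1 !natrD; ring.
by rewrite poly_intB !poly_intZ => /eqP; rewrite subr_eq0 => /eqP.
Qed.

Let int_WS p : (2 * p + 3)%:R * I (W ^+ p.+1) = (2 * p + 2)%:R * h ^+ 2 * I (W ^+ p).
Proof.
have : I ((y * W ^+ p.+1)^`()) = 0.
  by rewrite poly_intE !hornerM !horner_exp !Wab !subrr !(mulr0, mul0r, expr0n) subrr.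
have -> : (y * W ^+ p.+1)^`() =
    (2 * p + 3)%:R *: W ^+ p.+1 - ((2 * p + 2)%:R * h ^+ 2) *: W ^+ p.
  have hW : (h ^+ 2)%:P = W + y ^+ 2 by rewrite /W subrK.
  rewrite derivM deriv_exp dy dW /= -scalerA -(mul_polyC (h ^+ 2)) hW.
  by rewrite !scaler_nat !exprS; ring.
by rewrite poly_intB !poly_intZ => /eqP; rewrite subr_eq0 => /eqP.
Qed.

Let int_WJ p : (p.*2 < N.+1)%N -> cos_moment p.*2 * I (W ^+ p) = I (y ^+ p.*2).
Proof.
elim: p => [_|p IH pN]; first by rewrite cos_moment0 mul1r !expr0.
have pos k : (k.+1)%:R != 0 :> R by rewrite pnatr_eq0.
have p3 : (2 * p + 3)%:R != 0 :> R by rewrite addn3 pos.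
have p2 : (p.*2.+2)%:R != 0 :> R by rewrite pos.
apply: (mulfI p3); apply: (mulfI p2).
have pN' : (p.*2.+2 < N.+1)%N := pN.
rewrite -[in RHS]/(p.*2.+2) [in RHS]int_ySS -IH; last by apply: ltn_trans pN'.
have H1 := cos_momentSS pN'; have H2 := int_WS p.
transitivity ((p.*2.+2%:R * cos_moment p.*2.+2) * ((2 * p + 3)%:R * I (W ^+ p.+1))).
  by ring.
by rewrite H1 H2 -mul2n !natrD -!natr1; ring.
Qed.

Let int_WWJ p : (p.*2 < N.+1)%N -> cos_moment p.*2 * I (W ^+ p.+1) =
  (h ^+ 2 * I (y ^+ p.*2) + I (y ^+ p.*2.+2)) / 2.
Proof.
move=> pN; have p3 : (2 * p + 3)%:R != 0 :> R by rewrite addn3 pnatr_eq0.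
apply: (mulfI p3); rewrite mulrCA int_WS.
rewrite [RHS]mulrA [in RHS]mulrDr int_ySS -(int_WJ pN) !natrD; by field.
Qed.

Variable P : {poly R}.
Hypothesis PN : (size P <= N.+1)%N.
Let S := P \Po ('X + c%:P).

Let PE : P = \sum_(m < size S) S`_m *: y ^+ m.
Proof.
have {1}-> : P = S \Po y.
  rewrite /S -comp_polyA comp_polyD comp_polyX comp_polyC /y subrK.
  by rewrite comp_polyXr.
by rewrite comp_polyE.
Qed.

Let size_S : (size S <= N.+1)%N.
Proof.
rewrite /S; apply: leq_trans PN.
have [->|P0] := eqVneq P 0; first by rewrite comp_poly0 size_poly0.
by rewrite size_comp_poly2 // size_XaddC.
Qed.

(** The circle mean of P with centre c and squared radius W, as a polynomial:
    the odd powers of the radius have mean zero, which removes the root. *)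
Definition circle_poly : {poly R} :=
  \sum_(m < size S) S`_m *: (cos_moment m *: (if odd m then 0 else W ^+ m./2)).

Lemma circle_polyE x : a <= x <= b ->
  circle_poly.[x] = circle_mean (horner P) c (Num.sqrt ((x - a) * (b - x))).
Proof.
move=> /andP[ax xb]; set r := Num.sqrt _.
have r2 : r ^+ 2 = W.[x] by rewrite Wab sqr_sqrtr // mulr_ge0 ?subr_ge0.
rewrite /circle_mean [in RHS]PE.
under [in RHS]eq_bigr do rewrite horner_sum.
rewrite exchange_big mulr_sumr horner_sum /=; apply: eq_bigr => m _.
transitivity (S`_m * (r ^+ m * cos_moment m)).
  rewrite !hornerZ; congr (_ * _); rewrite mulrC.
  case: ifPn => mo; first by rewrite cos_moment_odd ?horner0 ?mulr0 ?mul0r // (leq_trans (ltn_ord m)).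
  have -> : r ^+ m = (r ^+ 2) ^+ m./2.
    by rewrite -exprM mul2n -{1}(odd_double_half m) (negbTE mo).
  by rewrite r2 horner_exp.
rewrite /cos_moment [LHS]mulrA [LHS]mulrCA; congr (_ * _).
rewrite mulr_sumr; apply: eq_bigr => j _.
rewrite hornerZ horner_exp /y !hornerE addrAC subrr add0r exprMn; ring.
Qed.

(** Two orthogonal coordinates of a uniform point of a sphere have the same
    law, uniform on an interval, and when the first one is fixed the second one
    is the projection of a circle of squared radius W. For powers of X - c the
    two sides obey the same recurrence. *)
Lemma archimedes : I circle_poly = I P.
Proof.
rewrite [in RHS]PE /circle_poly !poly_int_sum; apply: eq_bigr => m _.
rewrite !poly_intZ; congr (_ * _); case: ifPn => mo.
  by rewrite poly_int0 mulr0 int_y_odd.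
have E : m./2.*2 = m by rewrite -[RHS]odd_double_half (negbTE mo).
by have := @int_WJ m./2; rewrite E; apply; exact: leq_trans (ltn_ord m) size_S.
Qed.

(** On the sphere: the mean of the squared radius, given the second coordinate
    y counted from c, is half of h^2 + y^2. *)
Lemma archimedes_weight :
  I (W * circle_poly) = (h ^+ 2 * I P + I (y ^+ 2 * P)) / 2.
Proof.
rewrite [in RHS]PE /circle_poly !mulr_sumr !poly_int_sum mulr_sumr -big_split.
rewrite mulr_suml; apply: eq_bigr => m _ /=.
rewrite -!scalerAr !poly_intZ [h ^+ 2 * _]mulrCA -[in RHS]mulrDr -[RHS]mulrA.
congr (_ * _).
rewrite -exprD add2n.
case: ifPn => mo.
  by rewrite mulr0 poly_int0 mulr0 !int_y_odd ?mulr0 ?addr0 ?mul0r //= negbK.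
have E : m./2.*2 = m by rewrite -[RHS]odd_double_half (negbTE mo).
rewrite -exprS.
by have := @int_WWJ m./2; rewrite E; apply; exact: leq_trans (ltn_ord m) size_S.
Qed.

(** By [archimedes_weight] the mean of W is at least h^2 / 2; the powers follow
    by adding up tangents as in Jensen's inequality. *)
Lemma archimedes_power k : a <= b -> (forall x, 0 <= P.[x]) ->
  (h ^+ 2 / 2) ^+ k * I P <= I (W ^+ k * circle_poly).
Proof.
move=> ab P0; set A := circle_poly.
have A0 x : a <= x <= b -> 0 <= A.[x].
  move=> xab; rewrite /A circle_polyE // mulr_ge0 ?invr_ge0 //.
  by apply: sumr_ge0.
case: k => [|k]; first by rewrite !expr0 !mul1r archimedes.
pose s := h ^+ 2 / 2.
have s0 : 0 <= s by rewrite divr_ge0 ?sqr_ge0.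
have W0 x : a <= x <= b -> 0 <= W.[x].
  by move=> /andP[ax xb]; rewrite Wab mulr_ge0 ?subr_ge0.
have : 0 <= I (W ^+ k.+1 * A - (k.+1%:R * s ^+ k) *: (W * A) + (k%:R * s ^+ k.+1) *: A).
  apply: poly_int_ge0 => // x xab.
  rewrite hornerD hornerD hornerN !hornerZ !hornerM horner_exp.
  have := young_expr k s0 (W0 x xab) => H.
  rewrite (_ : _ + _ = (W.[x] ^+ k.+1 + k%:R * s ^+ k.+1 - k.+1%:R * s ^+ k * W.[x]) * A.[x]).
    by rewrite mulr_ge0 ?A0 // subr_ge0.
  by ring.
rewrite poly_intD poly_intB !poly_intZ archimedes_weight archimedes.
have y2 : 0 <= I (y ^+ 2 * P).
  by apply: poly_int_ge0 => // x _; rewrite hornerM horner_exp mulr_ge0 ?sqr_ge0.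
have Z : 0 <= k.+1%:R * s ^+ k * I (y ^+ 2 * P) / 2.
  by rewrite divr_ge0 // mulr_ge0 // mulr_ge0 ?exprn_ge0.
move=> H; rewrite -/s -subr_ge0; apply: le_trans (addr_ge0 H Z) _.
rewrite le_eqVlt; apply/orP; left; apply/eqP.
rewrite (_ : h ^+ 2 = 2 * s); last by rewrite /s; field.
by clearbody s; rewrite !exprS -natr1; field.
Qed.

End CircleAverage.

(** * Level sets of a unimodal density and the law on its subgraph *)

Section Edge.
Context {R : realType}.
Variables (g : R -> R) (x0 : R).

(** The right end of the level set of g above s, to the right of x0. The point
    x0 itself is thrown in to keep the set nonempty at every height. *)
Definition edge (s : R) : R :=
  if 0 < s then sup [set x | x = x0 \/ (x0 <= x /\ s < g x)] else x0.

Hypothesis g_ni : forall x y, x0 <= x -> x <= y -> g y <= g x.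
Hypothesis g_tail : forall s x, 0 < s -> x0 <= x -> s < g x -> s * (x - x0) <= 1.

Let E s := [set x | x = x0 \/ (x0 <= x /\ s < g x)].

Let E_sup s : 0 < s -> has_sup (E s).
Proof.
move=> s0; split; first by exists x0; left.
exists (x0 + s^-1) => x [->|[x0x sx]]; first by rewrite lerDl invr_ge0 ltW.
by rewrite -lerBlDl -[leRHS]mul1r ler_pdivlMr // mulrC g_tail.
Qed.

Lemma edge_ub s x : 0 < s -> x0 <= x -> s < g x -> x <= edge s.
Proof.
move=> s0 x0x sx; rewrite /edge s0; apply: (ub_le_sup (E_sup s0).2).
by right.
Qed.

Lemma edge_ge s : x0 <= edge s.
Proof.
rewrite /edge; case: ifPn => // s0; apply: (ub_le_sup (E_sup s0).2).
by left.
Qed.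

Lemma edge_lt s x : 0 < s -> x0 <= x -> x < edge s -> s < g x.
Proof.
move=> s0 x0x; rewrite /edge s0 => xs.
have [y Ey xy] := sup_adherent (eqbRL (subr_gt0 _ _) xs) (E_sup s0).
rewrite subKr in xy; case: Ey => [yx0|[x0y sy]].
  by move: xy; rewrite yx0 ltNge x0x.
by apply: lt_le_trans sy _; apply: g_ni => //; exact: ltW.
Qed.

Lemma edge_anti s t : 0 < s -> s <= t -> edge t <= edge s.
Proof.
move=> s0 st; have t0 := lt_le_trans s0 st.
rewrite {1}/edge t0; apply: ge_sup; first by exists x0; left.
move=> x [->|[x0x tx]]; first exact: edge_ge.
by apply: edge_ub => //; exact: le_lt_trans tx.
Qed.

Lemma measurable_edge : measurable_fun [set: R] edge.
Proof.
apply: (measurability (@RGenCInfty.G R)) => [|/= _ [_] [r] -> <-].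
  exact: RGenCInfty.measurableE.
apply: measurableI => //; apply: is_interval_measurable => s t/=.
rewrite !in_itv/= !andbT => rs rt u /andP[su ut].
rewrite in_itv /= andbT; have [u0|u0] := ltP 0 u.
  by apply: le_trans rt _; exact: edge_anti.
by move: rs; rewrite /edge !ltNge u0 (le_trans su u0).
Qed.

End Edge.

Lemma lebesgue_measure_cc {R : realType} (u v : R) : u <= v ->
  lebesgue_measure `[u, v]%classic = (v - u)%:E.
Proof.
move=> uv; rewrite lebesgue_measure_itv /= lte_fin.
case: ltP => [//|vu]; rewrite (_ : v = u) ?subrr //.
by apply/eqP; rewrite eq_le uv vu.
Qed.

Lemma lebesgue_measure_oo {R : realType} (u v : R) : u <= v ->
  lebesgue_measure `]u, v[%classic = (v - u)%:E.
Proof.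
move=> uv; rewrite lebesgue_measure_itv /= lte_fin.
case: ltP => [//|vu]; rewrite (_ : v = u) ?subrr //.
by apply/eqP; rewrite eq_le uv vu.
Qed.

Lemma measurable_circle_mean {R : realType} d (T : measurableType d) N
    (P : {poly R}) (c r : T -> R) :
  measurable_fun [set: T] c -> measurable_fun [set: T] r ->
  measurable_fun [set: T] (fun z => circle_mean N (horner P) (c z) (r z)).
Proof.
move=> mc mr; apply: measurable_funM => //; apply: measurable_sum => j.
apply: measurableT_comp.
  by apply: continuous_measurable_fun; exact: continuous_horner.
by apply: measurable_funD => //; exact: measurable_funM.
Qed.

Section LevelSets.
Context {R : realType}.
Local Notation leb := (@lebesgue_measure R).
Variables (rho : R -> R) (x0 : R).
Hypothesis mrho : measurable_fun [set: R] rho.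
Hypothesis rho_ge0 : forall x, 0 <= rho x.
Hypothesis rho1 : (\int[leb]_x (rho x)%:E)%E = 1%E.
Hypothesis rho_nd : forall x y, x <= y -> y <= x0 -> rho x <= rho y.
Hypothesis rho_ni : forall x y, x0 <= x -> x <= y -> rho y <= rho x.

Definition right_edge := edge rho x0.
Definition left_edge s := - edge (fun x => rho (- x)) (- x0) s.

Let tail_mass u v s : 0 < s -> u <= v ->
  (forall x, u <= x <= v -> s <= rho x) -> s * (v - u) <= 1.
Proof.
move=> s0 uv H; rewrite -lee_fin -[leRHS]rho1.
apply: (@le_trans _ _ (\int[leb]_(x in `[u, v]) (rho x)%:E)%E); last first.
  apply: ge0_subset_integral => //.
    exact/measurable_EFinP.
  by move=> x _; rewrite lee_fin.
apply: (@le_trans _ _ (\int[leb]_(x in `[u, v]) (cst s%:E x))%E).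
  rewrite integral_cst // EFinM le_eqVlt; apply/orP; left; apply/eqP.
  by congr (_ * _)%E; apply/esym; exact: lebesgue_measure_cc.
apply: ge0_le_integral => //.
- by move=> x _; rewrite lee_fin ltW.
- apply/measurable_EFinP; exact: measurable_funTS.
Qed.

Let right_tail s x : 0 < s -> x0 <= x -> s < rho x -> s * (x - x0) <= 1.
Proof.
move=> s0 x0x sx; apply: tail_mass => // y /andP[x0y yx].
by apply: le_trans (ltW sx) _; exact: rho_ni.
Qed.

Let left_ni x y : - x0 <= x -> x <= y -> rho (- y) <= rho (- x).
Proof. by move=> x0x xy; apply: rho_nd; rewrite ?lerN2 // lerNl. Qed.

Let left_tail s x : 0 < s -> - x0 <= x -> s < rho (- x) -> s * (x - - x0) <= 1.
Proof.
move=> s0 x0x sx; rewrite opprK addrC -[x]opprK; apply: tail_mass => //.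
  by rewrite lerNl.
move=> y /andP[xy yx0]; apply: le_trans (ltW sx) _; exact: rho_nd.
Qed.

Lemma right_edge_ge s : x0 <= right_edge s.
Proof. exact: edge_ge. Qed.

Lemma left_edge_le s : left_edge s <= x0.
Proof. by rewrite lerNl; exact: edge_ge. Qed.

Lemma left_le_right_edge s : left_edge s <= right_edge s.
Proof. exact: le_trans (left_edge_le s) (right_edge_ge s). Qed.

Lemma level_set_sub s x : 0 < s -> s < rho x -> left_edge s <= x <= right_edge s.
Proof.
move=> s0 sx; have [x0x|xx0] := leP x0 x.
  rewrite (le_trans (left_edge_le s) x0x) /=; exact: edge_ub.
rewrite (le_trans (ltW xx0) (right_edge_ge s)) andbT lerNl.
by apply: edge_ub => //; rewrite ?opprK // lerN2 ltW.
Qed.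

(** Together with [level_set_sub]: a level set is the interval between its
    edges, up to the two end points. *)
Lemma level_set_sup s x : 0 < s -> left_edge s < x < right_edge s -> s < rho x.
Proof.
move=> s0 /andP[ax xb]; have [x0x|xx0] := leP x0 x.
  exact: edge_lt xb.
rewrite -[x]opprK; apply: (@edge_lt _ (fun x => rho (- x)) (- x0)) => //.
  by rewrite lerN2 ltW.
by rewrite ltrNl.
Qed.

Lemma measurable_right_edge : measurable_fun [set: R] right_edge.
Proof. exact: measurable_edge. Qed.

Lemma measurable_left_edge : measurable_fun [set: R] left_edge.
Proof. by apply: measurableT_comp => //; exact: measurable_edge. Qed.

Definition width s := right_edge s - left_edge s.

Lemma width_ge0 s : 0 <= width s.
Proof. by rewrite subr_ge0 left_le_right_edge. Qed.

Lemma width_anti s t : 0 < s -> s <= t -> width t <= width s.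
Proof.
move=> s0 st; rewrite lerB //; first exact: edge_anti.
by rewrite lerN2; exact: edge_anti.
Qed.

Lemma measurable_width : measurable_fun [set: R] width.
Proof. by apply: measurable_funB; [exact: measurable_right_edge|exact: measurable_left_edge]. Qed.

Lemma measurable_level (s : R) : measurable [set x : R | s < rho x].
Proof.
by rewrite -[X in measurable X]setTI -preimage_itvoy; apply: mrho.
Qed.

Lemma integral_level_set (s : R) (f : R -> \bar R) : 0 < s ->
  measurable_fun [set: R] f -> (forall x, 0 <= f x)%E ->
  (\int[leb]_(x in [set x : R | (s < rho x)%R]) f x =
   \int[leb]_(x in `[left_edge s, right_edge s]) f x)%E.
Proof.
move=> s0 mf f0; apply/eqP; rewrite eq_le; apply/andP; split.
  apply: ge0_subset_integral => //.
  - exact: measurable_level.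
  - exact: measurable_funTS.
  - by move=> x /= sx; rewrite in_itv /= level_set_sub.
rewrite (@integral_itv_bndoo _ _ _ _ true false); last exact: measurable_funTS.
apply: ge0_subset_integral => //.
- exact: measurable_level.
- exact: measurable_funTS.
- by move=> x /=; rewrite in_itv /= => /level_set_sup; apply.
Qed.

Local Notation T2 := (measurableTypeR R * measurableTypeR R)%type.
Local Notation leb2 := (leb \x leb)%E.

Definition subgraph : set T2 := [set z | 0 < z.2 < rho z.1].

Lemma measurable_subgraph : measurable subgraph.
Proof.
have mb (b : T2 -> bool) : measurable_fun [set: T2] b -> measurable [set z | b z].
  move=> mf; rewrite -[X in measurable X]setTI.
  by apply: (mf measurableT [set true]).
apply: mb; apply: measurable_and; apply: measurable_fun_ltr => //.
exact: measurableT_comp.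
Qed.

Section SubgraphIntegral.
Variable f : T2 -> \bar R.
Hypothesis mf : measurable_fun [set: T2] f.
Hypothesis f_ge0 : forall z, (0 <= f z)%E.

Let mfG : measurable_fun [set: T2] (f \_ subgraph).
Proof.
apply/(measurable_restrictT f measurable_subgraph); exact: measurable_funTS.
Qed.

Let fG_ge0 z : (0 <= (f \_ subgraph) z)%E.
Proof. by rewrite patchE; case: ifP. Qed.

Lemma integral_subgraph_x :
  (\int[leb2]_(z in subgraph) f z =
   \int[leb]_x \int[leb]_(s in `]0%R, rho x[) f (x, s))%E.
Proof.
rewrite integral_mkcond fubini_tonelli1 //; apply: eq_integral => x _.
rewrite /fubini_F [RHS]integral_mkcond; apply: eq_integral => s _.
by rewrite !patchE; congr (if _ then _ else _).
Qed.

Lemma integral_subgraph_s :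
  (\int[leb2]_(z in subgraph) f z =
   \int[leb]_(s in `]0%R, +oo[) \int[leb]_(x in [set x : R | (s < rho x)%R]) f (x, s))%E.
Proof.
rewrite integral_mkcond fubini_tonelli2 // [RHS]integral_mkcond.
apply: eq_integral => s _; rewrite patchE; case: ifPn.
  rewrite inE /= in_itv /= andbT => s0; rewrite /fubini_G [RHS]integral_mkcond.
  apply: eq_integral => x _; rewrite !patchE; congr (if _ then _ else _).
  by apply/idP/idP; rewrite !inE /subgraph /= s0.
rewrite notin_setE /= in_itv /= andbT => s0; rewrite /fubini_G integral0_eq // => x _.
by rewrite patchE memNset // /subgraph /= => /andP[].
Qed.

Lemma integral_subgraph :
  (\int[leb2]_(z in subgraph) f z =
   \int[leb]_(s in `]0%R, +oo[) \int[leb]_(x in `[left_edge s, right_edge s]) f (x, s))%E.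
Proof.
rewrite integral_subgraph_s; apply: eq_integral => s.
rewrite inE /= in_itv /= andbT => s0.
apply: integral_level_set => //; exact: measurableT_comp.
Qed.

End SubgraphIntegral.

Lemma measure_level (s : R) : 0 < s -> leb [set x | s < rho x] = (width s)%:E.
Proof.
move=> s0.
transitivity (\int[leb]_(x in [set x : R | (s < rho x)%R]) cst 1 x)%E.
  rewrite integral_cst ?mul1e //; exact: measurable_level.
rewrite integral_level_set // integral_cst // mul1e.
exact: lebesgue_measure_cc (left_le_right_edge s).
Qed.

Lemma integral_width : (\int[leb]_(s in `]0%R, +oo[) (width s)%:E = 1)%E.
Proof.
rewrite -rho1.
transitivity (\int[leb2]_(z in subgraph) (cst 1 z))%E.
  rewrite integral_subgraph_s //; apply: eq_integral => s.
  rewrite inE /= in_itv /= andbT => s0.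
  rewrite -[LHS]measure_level // integral_cst ?mul1e //; exact: measurable_level.
rewrite integral_subgraph_x //; apply: eq_integral => x _.
rewrite integral_cst // mul1e -[in RHS](subr0 (rho x)).
exact: lebesgue_measure_oo.
Qed.

Variable M : R.
Hypothesis M_gt0 : 0 < M.
Hypothesis rho_le : {ae leb, forall x, rho x <= M}.

Lemma width_eq0 s : M <= s -> width s = 0.
Proof.
move=> Ms; have s0 := lt_le_trans M_gt0 Ms.
suff : leb [set x | s < rho x] = 0%E by rewrite measure_level // => -[].
apply: measure_negligible; first exact: measurable_level.
apply: negligibleS rho_le => x /= sx H.
by move: sx; rewrite ltNge (le_trans H Ms).
Qed.

(** The widths integrate to 1 and vanish above M, so their mean over heights
    below M is 1 / M. As they are nonincreasing, the mean over the heights below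
    u is no smaller, and Jensen's inequality passes to powers. *)
Lemma jensen_width u k : 0 <= u <= M ->
  (u%:E <= \int[leb]_(s in `]0%R, u[) ((M * width s) ^+ k)%:E)%E.
Proof.
move=> /andP[]; rewrite le_eqVlt => /predU1P[<- _|u0 uM].
  by rewrite set_itvoo0 // integral_set0.
have mw : measurable_fun [set: R] (EFin \o width).
  by apply/measurable_EFinP; exact: measurable_width.
have cst_itv c : (\int[leb]_(s in `]0%R, u[) c%:E = (c * u)%:E)%E.
  rewrite integral_cst // EFinM -[in RHS](subr0 u); congr (_ * _)%E.
  by apply: lebesgue_measure_oo; exact: ltW.
set A := (\int[leb]_(s in `]0%R, u[) (width s)%:E)%E.
have A0 : (0 <= A)%E by apply: integral_ge0 => s _; rewrite lee_fin width_ge0.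
have uA : ((width u * u)%:E <= A)%E.
  rewrite -cst_itv; apply: ge0_le_integral => //.
  - by move=> s _; rewrite lee_fin width_ge0.
  - exact: measurable_funTS.
  - move=> s /=; rewrite in_itv /= => /andP[s0 su].
    by rewrite lee_fin width_anti // ltW.
have A1 : (1 <= A + (width u * (M - u))%:E)%E.
  rewrite -integral_width (_ : `]0%R, +oo[%classic = `]0%R, u[ `|` `[u, +oo[); last first.
    by rewrite -itv_bndbnd_setU // bnd_simp // ltW.
  rewrite ge0_integral_setU //; last 3 first.
  - exact: measurable_funTS.
  - by move=> s _; rewrite lee_fin width_ge0.
  - apply/disj_setPS => s /= []; rewrite !in_itv /= andbT => /andP[_ su].
    by rewrite leNgt su.
  rewrite leeD2l // (_ : (width u * (M - u))%:E = \int[leb]_(s in `[u, M]) (cst (width u)%:E s))%E; last first.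
    rewrite integral_cst // EFinM; congr (_ * _)%E.
    by apply/esym; exact: lebesgue_measure_cc.
  rewrite integral_mkcond [leRHS]integral_mkcond; apply: ge0_le_integral => //.
  - by move=> s _; rewrite patchE; case: ifP => // _; rewrite lee_fin width_ge0.
  - have mI : measurable `[u, +oo[%classic by [].
    exact: (measurable_restrictT _ mI).1 (measurable_funTS mw).
  - have mI : measurable `[u, M]%classic by [].
    exact: (measurable_restrictT _ mI).1 (measurable_cst _).
  - move=> s _; rewrite !patchE.
    case: ifPn => [|_]; last by case: ifPn => // _; rewrite lee_fin width_ge0.
    rewrite inE /= in_itv /= andbT => us; case: ifPn.
      by move=> _; rewrite lee_fin width_anti.
    rewrite notin_setE /= in_itv /= us /= => /negP; rewrite -ltNge => Ms.
    by rewrite width_eq0 // ltW.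
have Afin : A \is a fin_num.
  rewrite ge0_fin_numE //; apply: (@le_lt_trans _ _ 1%E); last by rewrite ltry.
  rewrite -integral_width; apply: ge0_subset_integral => //.
  - exact: measurable_funTS.
  - by move=> s _; rewrite lee_fin width_ge0.
  - by move=> s /=; rewrite !in_itv /= => /andP[->].
have MA : u <= M * fine A.
  move: uA A1; rewrite -(fineK Afin) -EFinD !lee_fin; set a := fine A => uA A1.
  have H1 : 0 <= u * (a + width u * (M - u) - 1).
    by rewrite mulr_ge0 ?subr_ge0 // ltW.
  have H2 : 0 <= (M - u) * (a - width u * u) by rewrite mulr_ge0 ?subr_ge0.
  rewrite /= -subr_ge0.
  apply: le_trans (addr_ge0 H2 H1) _; rewrite le_eqVlt; apply/orP; left.
  by apply/eqP; ring.
have step : ((u + k%:R * (M * fine A))%:E <=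
    \int[leb]_(s in `]0%R, u[) ((M * width s) ^+ k)%:E + (k%:R * u)%:E)%E.
  rewrite -cst_itv -ge0_integralD //; last 2 first.
  - by move=> s _; rewrite lee_fin exprn_ge0 // mulr_ge0 ?width_ge0 // ltW.
  - apply/measurable_EFinP; apply: measurable_funX; apply: measurable_funM => //.
    by apply: measurable_funTS; exact: measurable_width.
  rewrite (_ : (u + k%:R * (M * fine A))%:E =
     (\int[leb]_(s in `]0%R, u[) (1%:E + (k%:R * M)%:E * (width s)%:E))%E); last first.
    rewrite ge0_integralD //; last 2 first.
    - by move=> s _; rewrite -EFinM lee_fin !mulr_ge0 ?width_ge0 // ltW.
    - by apply: measurable_funeM; exact: measurable_funTS.
    rewrite cst_itv mul1r ge0_integralZl //; last 3 first.
    - exact: measurable_funTS.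
    - by move=> s _; rewrite lee_fin width_ge0.
    - by rewrite lee_fin mulr_ge0 // ltW.
    by rewrite EFinD mulrA EFinM fineK.
  apply: ge0_le_integral => //.
  - move=> s _; rewrite -EFinM -EFinD lee_fin addr_ge0 //.
    by rewrite !mulr_ge0 ?width_ge0 // ltW.
  - apply: emeasurable_funD => //; apply: measurable_funeM; exact: measurable_funTS.
  - apply: emeasurable_funD => //; apply/measurable_EFinP; apply: measurable_funX.
    by apply: measurable_funM => //; apply: measurable_funTS; exact: measurable_width.
  - move=> s _; rewrite -EFinM -!EFinD lee_fin.
    have : 0 <= M * width s by rewrite mulr_ge0 ?width_ge0 // ltW.
    rewrite -mulrA; case: k => [|k]; first by rewrite mul0r expr0.
    move=> /(young_expr k (@ler01 R)); rewrite !expr1n !mulr1 => H.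
    by rewrite -[X in _ <= _ + X]natr1 addrA [leLHS]addrC lerD2r.
set I := (X in (_ <= X)%E); rewrite -/I in step.
have : ((u + k%:R * u)%:E <= I + (k%:R * u)%:E)%E.
  by apply: le_trans step; rewrite lee_fin lerD2l ler_wpM2l.
by rewrite EFinD leeD2rE.
Qed.

Definition centre (z : T2) : R := (left_edge z.2 + right_edge z.2) / 2.

(** A point (x, s) of the subgraph selects the level set at height s and, in
    it, the circle that [archimedes] associates with x. *)
Definition radius (z : T2) : R :=
  Num.sqrt ((z.1 - left_edge z.2) * (right_edge z.2 - z.1)).

Let mleft : measurable_fun [set: T2] (fun z => left_edge z.2).
Proof. apply: measurableT_comp => //; exact: measurable_left_edge. Qed.

Let mright : measurable_fun [set: T2] (fun z => right_edge z.2).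
Proof. apply: measurableT_comp => //; exact: measurable_right_edge. Qed.

Lemma measurable_centre : measurable_fun [set: T2] centre.
Proof. by apply: measurable_funM => //; exact: measurable_funD. Qed.

Lemma measurable_radius : measurable_fun [set: T2] radius.
Proof.
apply: measurableT_comp.
  by apply: continuous_measurable_fun; exact: sqrt_continuous.
by apply: measurable_funM; exact: measurable_funB.
Qed.

Section Transfer.
Variables (N : nat) (P : {poly R}).
Hypothesis P_ge0 : forall x, 0 <= P.[x].
Hypothesis size_P : (size P <= N.+1)%N.
Let mean z := circle_mean N (horner P) (centre z) (radius z).

Let mean_ge0 z : 0 <= mean z.
Proof. by rewrite mulr_ge0 ?invr_ge0 // sumr_ge0. Qed.

Let mmean : measurable_fun [set: T2] mean.
Proof.
by apply: measurable_circle_mean; [exact: measurable_centre|exact: measurable_radius].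
Qed.

Let mP : measurable_fun [set: R] (horner P).
Proof. by apply: continuous_measurable_fun; exact: continuous_horner. Qed.

Let mP1 : measurable_fun [set: T2] (fun z => P.[z.1]).
Proof. exact: measurableT_comp. Qed.

Lemma integral_subgraph_circle_mean :
  (\int[leb2]_(z in subgraph) (P.[z.1])%:E = \int[leb2]_(z in subgraph) (mean z)%:E)%E.
Proof.
rewrite !integral_subgraph; last 4 first.
- exact/measurable_EFinP.
- by move=> z; rewrite lee_fin.
- exact/measurable_EFinP.
- by move=> z; rewrite lee_fin.
apply: eq_integral => s; rewrite inE /= in_itv /= andbT => s0.
have ab := left_le_right_edge s.
rewrite integral_poly_int // -(archimedes _ _ size_P) -integral_poly_int //.
apply: eq_integral => x; rewrite inE /= in_itv /= => xab.
by rewrite circle_polyE.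
Qed.

(** Two exchanges: in the vertical direction [jensen_width] brings in a power
    of the width of the level set, and in the horizontal direction
    [archimedes_power] trades that width for the radius. *)
Lemma integral_subgraph_circle_mean_radius k :
  (\int[leb2]_(z in subgraph) (P.[z.1])%:E <=
   ((8 * M ^+ 2) ^+ k)%:E *
   \int[leb2]_(z in subgraph) (radius z ^+ k.*2 * mean z)%:E)%E.
Proof.
have mw : measurable_fun [set: T2] (fun z => (M * width z.2) ^+ k.*2).
  apply: measurable_funX; apply: measurable_funM => //.
  by apply: measurableT_comp => //; exact: measurable_width.
have w0 (s : R) : 0 <= (M * width s) ^+ k.*2.
  by rewrite exprn_ge0 // mulr_ge0 ?width_ge0 // ltW.
pose f (z : T2) := ((M * width z.2) ^+ k.*2 * P.[z.1])%:E.
have mf : measurable_fun [set: T2] f by apply/measurable_EFinP; exact: measurable_funM.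
have f0 z : (0 <= f z)%E by rewrite lee_fin mulr_ge0.
apply: (@le_trans _ _ (\int[leb2]_(z in subgraph) f z)%E).
  rewrite !integral_subgraph_x //; last 2 first.
  - exact/measurable_EFinP.
  - by move=> z; rewrite lee_fin.
  have mk (g : T2 -> \bar R) : measurable_fun [set: T2] g -> (forall z, 0 <= g z)%E ->
     measurable_fun [set: R] (fun x => \int[leb]_(s in `]0%R, rho x[) g (x, s))%E.
    move=> mg g0.
    have mgG : measurable_fun [set: T2] (g \_ subgraph).
      apply/(measurable_restrictT g measurable_subgraph); exact: measurable_funTS.
    rewrite (_ : (fun x => _) = fubini_F leb (g \_ subgraph)).
      apply: measurable_fun_fubini_tonelli_F => // z.
      by rewrite patchE; case: ifP.
    apply/funext => x; rewrite /fubini_F [LHS]integral_mkcond.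
    by apply: eq_integral => s _; rewrite !patchE; congr (if _ then _ else _).
  apply: ae_ge0_le_integral => //.
  - by move=> x _; apply: integral_ge0 => s _; rewrite lee_fin.
  - apply: (mk (fun z => (P.[z.1])%:E)); first exact/measurable_EFinP.
    by move=> z; rewrite lee_fin.
  - by move=> x _; apply: integral_ge0 => s _; exact: f0.
  - exact: mk.
  apply: negligibleS rho_le => x /=; apply: contra_not => rx _.
  rewrite [X in (X <= _)%E](_ : _ = (P.[x])%:E * (rho x)%:E)%E; last first.
    rewrite integral_cst // -[in RHS](subr0 (rho x)); congr (_ * _)%E.
    exact: lebesgue_measure_oo.
  rewrite /f /=; under eq_integral do rewrite EFinM muleC.
  rewrite ge0_integralZl //; last 3 first.
  - apply: measurable_funTS; apply/measurable_EFinP; apply: measurable_funX.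
    by apply: measurable_funM => //; exact: measurable_width.
  - by move=> s _; rewrite lee_fin.
  - by rewrite lee_fin.
  by rewrite lee_wpmul2l ?lee_fin // jensen_width // rho_ge0 rx.
have mg : measurable_fun [set: T2] (fun z => radius z ^+ k.*2 * mean z).
  by apply: measurable_funM => //; apply: measurable_funX; exact: measurable_radius.
have g0 z : 0 <= radius z ^+ k.*2 * mean z.
  by rewrite mulr_ge0 // exprn_ge0 // sqrtr_ge0.
rewrite -ge0_integralZl //; last 4 first.
- exact: measurable_subgraph.
- by apply: measurable_funTS; exact/measurable_EFinP.
- by move=> z _; rewrite lee_fin.
- by rewrite lee_fin exprn_ge0 // mulr_ge0 // sqr_ge0.
have mK : measurable_fun [set: T2]
    (fun z => ((8 * M ^+ 2) ^+ k)%:E * (radius z ^+ k.*2 * mean z)%:E)%E.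
  by apply: measurable_funeM; exact/measurable_EFinP.
have K0 z : (0 <= ((8 * M ^+ 2) ^+ k)%:E * (radius z ^+ k.*2 * mean z)%:E)%E.
  by rewrite -EFinM lee_fin mulr_ge0 // exprn_ge0 // mulr_ge0 // sqr_ge0.
have mk (g : T2 -> \bar R) : measurable_fun [set: T2] g -> (forall z, 0 <= g z)%E ->
    measurable_fun (`]0%R, +oo[%classic : set R)
      (fun s : R => \int[leb]_(x in [set x : R | (s < rho x)%R]) g (x, s))%E.
  move=> mg' g0'.
  have mgG : measurable_fun [set: T2] (g \_ subgraph).
    apply/(measurable_restrictT g measurable_subgraph); exact: measurable_funTS.
  apply: (eq_measurable_fun (fubini_G leb (g \_ subgraph))).
    move=> s; rewrite inE /= in_itv /= andbT => s0; rewrite /fubini_G [RHS]integral_mkcond.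
    apply: eq_integral => x _; rewrite !patchE; congr (if _ then _ else _).
    by apply/idP/idP; rewrite !inE /subgraph /= s0.
  apply: measurable_funTS; apply: measurable_fun_fubini_tonelli_G => // z.
  by rewrite patchE; case: ifP.
rewrite !integral_subgraph_s //; apply: ge0_le_integral => //.
- by move=> s _; apply: integral_ge0 => x _; exact: f0.
- exact: (mk f).
- exact: (mk (fun z => ((8 * M ^+ 2) ^+ k)%:E * (radius z ^+ k.*2 * mean z)%:E)%E).
move=> s /=; rewrite in_itv /= andbT => s0.
rewrite !integral_level_set //; last 2 first.
- exact: (measurableT_comp mK).
- exact: (measurableT_comp mf).
set a := left_edge s; set b := right_edge s.
have ab : a <= b by exact: left_le_right_edge.
rewrite /f /=; under eq_integral do rewrite EFinM.
rewrite !ge0_integralZl //; last 6 first.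
- apply: measurable_funTS; apply/measurable_EFinP.
  exact: (measurableT_comp mg (pair2_measurable s)).
- by move=> x _; rewrite lee_fin.
- by rewrite lee_fin exprn_ge0 // mulr_ge0 // sqr_ge0.
- by apply: measurable_funTS; exact/measurable_EFinP.
- by move=> x _; rewrite lee_fin.
- by rewrite lee_fin.
set W := ((((b - a) / 2) ^+ 2)%:P - ('X - ((a + b) / 2)%:P) ^+ 2) : {poly R}.
rewrite [X in (_ <= _ * X)%E](_ : _ = (poly_int a b (W ^+ k * circle_poly N a b P))%:E)%E.
  rewrite integral_poly_int // -!EFinM lee_fin.
  have := archimedes_power size_P k ab P_ge0; rewrite -/W => H.
  rewrite (_ : (M * width s) ^+ k.*2 = (8 * M ^+ 2) ^+ k * (((b - a) / 2) ^+ 2 / 2) ^+ k).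
    by rewrite -mulrA ler_wpM2l // exprn_ge0 // mulr_ge0 // sqr_ge0.
  by rewrite -exprMn -mul2n exprM /width -/a -/b; congr (_ ^+ _); field.
rewrite -integral_poly_int //; apply: eq_integral => x; rewrite inE /= in_itv /= => xab.
rewrite hornerM horner_exp circle_polyE //; congr (_ * _)%:E.
rewrite /radius /= -mul2n exprM sqr_sqrtr; last first.
  by case/andP: xab => ax xb; rewrite mulr_ge0 ?subr_ge0.
by congr (_ ^+ _); rewrite /W !hornerE /a /b; field.
Qed.

End Transfer.

(** The restriction already has mass 1; normalizing it equips it with the
    structure of a probability measure. *)
Definition subgraph_probability : probability T2 R :=
  mnormalize (mrestr leb2 measurable_subgraph) (dirac point).

Lemma subgraph_probabilityE (A : set T2) : subgraph_probability A = leb2 (A `&` subgraph).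
Proof.
have G1 : leb2 subgraph = 1%E.
  rewrite -integral_width -[LHS]mul1e -integral_cst; last exact: measurable_subgraph.
  rewrite integral_subgraph_s //; apply: eq_integral => s.
  rewrite inE /= in_itv /= andbT => s0.
  rewrite -[RHS]measure_level // integral_cst ?mul1e //; exact: measurable_level.
pose nu : {measure set T2 -> \bar R} := mrestr leb2 measurable_subgraph.
have E : nu setT = 1%E by rewrite /nu /= /mrestr setTI.
rewrite -[LHS]/(mnormalize nu (dirac point) A) /mnormalize E /=.
by rewrite onee_eq0 /= invr1 mule1.
Qed.

Lemma integral_subgraph_probability (f : T2 -> \bar R) :
  measurable_fun [set: T2] f -> (forall z, 0 <= f z)%E ->
  (\int[subgraph_probability]_z f z = \int[leb2]_(z in subgraph) f z)%E.
Proof.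
move=> mf f0; have mG := measurable_subgraph.
rewrite (ge0_negligible_integral (N := ~` subgraph)) //; last 2 first.
- exact: measurableC.
- by apply: etrans (subgraph_probabilityE _) _; rewrite setICl measure0.
rewrite setTD setCK; apply: eq_measure_integral => A mA AG.
apply: etrans (subgraph_probabilityE _) _; congr (leb2 _); exact/setIidPl.
Qed.

Lemma integral_density (mu : probability (measurableTypeR R) R) :
  (forall A : set (measurableTypeR R), measurable A ->
     mu A = \int[leb]_(x in A) (rho x)%:E)%E ->
  forall f : R -> \bar R, measurable_fun [set: R] f -> (forall x, 0 <= f x)%E ->
  (\int[mu]_x f x = \int[leb2]_(z in subgraph) f z.1)%E.
Proof.
move=> muE f mf f0.
rewrite -integral_subgraph_probability //; last first.
  exact: measurableT_comp.
transitivity (\int[pushforward subgraph_probability (fst : T2 -> measurableTypeR R)]_x f x)%E;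
  last by rewrite ge0_integral_pushforward.
apply: eq_measure_integral => A mA _; apply: etrans (muE A mA) _.
have mE : measurable ((fst : T2 -> measurableTypeR R) @^-1` A).
  by rewrite -[X in measurable X]setTI; exact: measurable_fst.
transitivity (\int[leb2]_(z in subgraph) (\1_((fst : T2 -> measurableTypeR R) @^-1` A) z)%:E)%E.
  rewrite integral_subgraph_x; last 2 first.
  - by apply/measurable_EFinP; exact: measurable_indic.
  - by move=> z; rewrite lee_fin.
  rewrite integral_mkcond; apply: eq_integral => x _.
  transitivity ((\1_A x)%:E * (rho x)%:E)%E.
    by rewrite patchE indicE; case: ifPn; rewrite ?mul1e ?mul0e.
  rewrite -[in LHS](subr0 (rho x)) (eq_integral (cst (\1_A x)%:E)) //.
  rewrite integral_cst //; congr (_ * _)%E; apply/esym; exact: lebesgue_measure_oo.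
rewrite integral_indic //; last exact: measurable_subgraph.
by apply/esym; exact: subgraph_probabilityE.
Qed.

End LevelSets.

(** The one-dimensional input: on polynomials, integration with respect to mu
    is an average of circle means, in which radii may be inserted at the price
    of a factor 8 M^2 for each of their squares. *)
Theorem arcsine_mixture {R : realType} (mu : probability (measurableTypeR R) R)
    (rho : R -> R) (M : R) :
  has_density mu rho -> unimodal rho -> 0 < M ->
  {ae lebesgue_measure, forall x, rho x <= M} ->
  exists (nu : probability (measurableTypeR R * measurableTypeR R)%type R)
    (c r : measurableTypeR R * measurableTypeR R -> R),
  [/\ measurable_fun [set: _] c, measurable_fun [set: _] r, forall z, 0 <= r z &
   forall N (P : {poly R}), (forall x, 0 <= P.[x]) -> (size P <= N.+1)%N ->
   (\int[mu]_x (P.[x])%:E =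
    \int[nu]_z (circle_mean N (horner P) (c z) (r z))%:E)%E /\
   forall k, (\int[mu]_x (P.[x])%:E <= ((8 * M ^+ 2) ^+ k)%:E *
     \int[nu]_z (r z ^+ k.*2 * circle_mean N (horner P) (c z) (r z))%:E)%E].
Proof.
move=> [mrho rho_ge0 muE] [x0 [nd ni]] M0 rhoM.
have rho1 : (\int[lebesgue_measure]_x (rho x)%:E = 1)%E.
  by apply: etrans (esym (muE setT measurableT)) _; exact: probability_setT.
have rho_nd x y : x <= y -> y <= x0 -> rho x <= rho y.
  by move=> xy yx0; apply: nd => //; rewrite in_itv /= ?(le_trans xy).
have rho_ni x y : x0 <= x -> x <= y -> rho y <= rho x.
  by move=> x0x xy; apply: ni => //; rewrite in_itv /= andbT // (le_trans x0x).
have mc := measurable_centre mrho rho_ge0 rho1 rho_nd rho_ni.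
have mr := measurable_radius mrho rho_ge0 rho1 rho_nd rho_ni.
exists (subgraph_probability mrho), (centre rho x0), (radius rho x0); split => //.
  by move=> z; exact: sqrtr_ge0.
move=> N P P0 sP.
have mm := measurable_circle_mean N P mc mr.
have mean0 z : 0 <= circle_mean N (horner P) (centre rho x0 z) (radius rho x0 z).
  by rewrite mulr_ge0 ?invr_ge0 // sumr_ge0.
have mP : measurable_fun [set: R] (EFin \o horner P).
  apply/measurable_EFinP; apply: continuous_measurable_fun; exact: continuous_horner.
have E := integral_density mrho rho_ge0 rho1 rho_nd rho_ni muE mP.
rewrite [X in X = _ /\ _]E; last by move=> x; rewrite lee_fin.
split.
  rewrite (integral_subgraph_probability mrho rho_ge0 rho1 rho_nd rho_ni) //.
  - exact: integral_subgraph_circle_mean.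
  - exact/measurable_EFinP.
move=> k; rewrite (integral_subgraph_probability mrho rho_ge0 rho1 rho_nd rho_ni) //.
- rewrite E; last by move=> x; rewrite lee_fin.
  exact: (integral_subgraph_circle_mean_radius mrho rho_ge0 rho1 rho_nd rho_ni M0).
- apply/measurable_EFinP; exact: measurable_funM (measurable_funX k.*2 mr) mm.
- by move=> z; rewrite lee_fin mulr_ge0 // exprn_ge0 // sqrtr_ge0.
Qed.

(** * Tensorization of one-dimensional comparisons *)

Section IntegralProdProbability.
Context {d : measure_display} {T : measurableType d} {R : realType}.
Variables (n : nat) (P : 'I_n.+1 -> probability T R).
Variable f : n.+1.-tuple T -> \bar R.
Hypothesis mf : measurable_fun [set: n.+1.-tuple T] f.
Hypothesis f_ge0 : forall x, (0 <= f x)%E.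
Local Notation P' := (prod_probability (fun i => P (lift ord0 i))).

Lemma measurable_tuple_consT : measurable_fun [set: T * n.-tuple T] (f \o @tuple_cons d T n).
Proof. by apply: measurableT_comp => //; exact: measurable_tuple_cons. Qed.

Lemma integral_prod_probability_cons :
  (\int[prod_probability P]_x f x =
   \int[P ord0]_x \int[P']_y f (tuple_cons (x, y)))%E.
Proof.
rewrite /= ge0_integral_pushforward //.
rewrite fubini_tonelli1 //; first exact: measurable_tuple_consT.
by move=> x; exact: f_ge0.
Qed.

End IntegralProdProbability.

Section TorusMean.
Context {R : realType}.
Variable N : nat.
Local Notation T1 := (measurableTypeR R).

Definition torus_mean n (c r : 'I_n -> R) (h : n.-tuple T1 -> R) : R :=
  N.+1%:R^-1 ^+ n * \sum_(p : {ffun 'I_n -> 'I_N.+1}) h [tuple torus_point c r p i | i < n].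

Lemma torus_mean_ge0 n (c r : 'I_n -> R) h :
  (forall x, 0 <= h x) -> 0 <= torus_mean c r h.
Proof. by move=> h0; rewrite mulr_ge0 ?exprn_ge0 ?invr_ge0 // sumr_ge0. Qed.

Lemma torus_mean_cons n (c r : 'I_n.+1 -> R) (h : n.+1.-tuple T1 -> R) :
  torus_mean c r h =
  circle_mean N (fun x => torus_mean (fun i => c (lift ord0 i)) (fun i => r (lift ord0 i))
     (fun y => h (tuple_cons (x, y)))) (c ord0) (r ord0).
Proof.
rewrite /torus_mean /circle_mean -mulr_sumr mulrA -exprS; congr (_ * _).
rewrite pair_big /=.
pose q (jp : 'I_N.+1 * {ffun 'I_n -> 'I_N.+1}) : {ffun 'I_n.+1 -> 'I_N.+1} :=
  [ffun i => if unlift ord0 i is Some k then jp.2 k else jp.1].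
pose q' (p : {ffun 'I_n.+1 -> 'I_N.+1}) := (p ord0, [ffun i => p (lift ord0 i)]).
rewrite (reindex q) /=; last first.
  exists q' => [[j p] _|p _]; rewrite /q /q'.
    rewrite ffunE unlift_none; congr (_, _); apply/ffunP => i.
    by rewrite !ffunE liftK.
  by apply/ffunP => i; rewrite ffunE; case: unliftP => [k ->|->] /=; rewrite ?ffunE.
apply: eq_bigr => -[j p] _; congr h; apply: eq_from_tnth => i.
rewrite tnth_mktuple /tuple_cons /=; case: (unliftP ord0 i) => [k ->|->].
  by rewrite tnthS tnth_mktuple /torus_point /q ffunE liftK.
by rewrite tnth0 /torus_point /q ffunE unlift_none.
Qed.

Lemma measurable_torus_mean d (T : measurableType d) n (c r : 'I_n -> T -> R)
    (h : T -> n.-tuple T1 -> R) :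
  (forall i, measurable_fun [set: T] (c i)) ->
  (forall i, measurable_fun [set: T] (r i)) ->
  measurable_fun [set: T * n.-tuple T1] (fun z => h z.1 z.2) ->
  measurable_fun [set: T] (fun z => torus_mean (c ^~ z) (r ^~ z) (h z)).
Proof.
move=> mc mr mh; apply: measurable_funM => //; apply: measurable_sum => p.
have mp : measurable_fun [set: T] (fun z =>
    [tuple torus_point (c ^~ z) (r ^~ z) p i | i < n] : n.-tuple T1).
  apply/measurable_fun_tnthP => i /=.
  apply: (eq_measurable_fun (fun z => torus_point (c ^~ z) (r ^~ z) p i)).
    by move=> z _ /=; rewrite tnth_mktuple.
  by apply: measurable_funD => //; apply: measurable_funM.
exact: (measurableT_comp mh (measurable_fun_pair (@measurable_id _ _ setT) mp)).
Qed.

(** Degree at most D in each variable separately: the class of integrands for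
    which one coordinate after the other can be replaced by circle means. *)
Fixpoint tuple_poly (D n : nat) : (n.-tuple T1 -> R) -> Prop :=
  match n with
  | 0 => fun _ => True
  | m.+1 => fun h =>
     (forall y : m.-tuple T1, exists2 P : {poly R}, (size P <= D.+1)%N &
        forall x, h (tuple_cons (x, y)) = P.[x])
     /\ (forall x, tuple_poly D (fun y => h (tuple_cons (x, y))))
  end.

Lemma tuple_poly_torus_mean D n (c r : 'I_n -> R) (h : n.+1.-tuple T1 -> R) u :
  tuple_poly D h -> exists2 P : {poly R}, (size P <= D.+1)%N &
    forall x, u * torus_mean c r (fun y => h (tuple_cons (x, y))) = P.[x].
Proof.
move=> [hP _].
have /choice[Q HQ] : forall p : {ffun 'I_n -> 'I_N.+1}, exists P : {poly R},
    (size P <= D.+1)%N /\ forall x, h (tuple_cons (x, [tuple torus_point c r p i | i < n])) = P.[x].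
  by move=> p; have [P] := hP [tuple torus_point c r p i | i < n]; exists P.
exists ((u * N.+1%:R^-1 ^+ n) *: \sum_p Q p).
  apply: leq_trans (size_scale_leq _ _) _.
  by apply: leq_trans (size_sum _ _ _) _; apply/bigmax_leqP => p _; case: (HQ p).
move=> x; rewrite /torus_mean hornerZ horner_sum mulrA; congr (_ * _).
by apply: eq_bigr => p _; case: (HQ p) => _ ->.
Qed.

End TorusMean.

Section Tensorization.
Context {R : realType}.
Local Notation T1 := (measurableTypeR R).
Context {d : measure_display} {T : measurableType d}.
Variable N : nat.
Variable rel : \bar R -> \bar R -> Prop.
Hypothesis rel_refl : forall a, rel a a.
Hypothesis rel_trans : forall a b e, rel a b -> rel b e -> rel a e.
Hypothesis rel_mul : forall (k : R) a b, 0 <= k -> rel a b -> rel (k%:E * a)%E (k%:E * b)%E.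
Hypothesis rel_integral : forall d' (S : measurableType d') (m : probability S R)
  (f g : S -> \bar R), measurable_fun [set: S] f -> measurable_fun [set: S] g ->
  (forall x, 0 <= f x)%E -> (forall x, 0 <= g x)%E ->
  (forall x, rel (f x) (g x)) -> rel (\int[m]_x f x)%E (\int[m]_x g x)%E.

(** The two parts of [arcsine_mixture] at once: rel is equality with w = 1, or
    the order with w an even power of the radius. *)
Definition mixture_rel (mu : probability T1 R) (nu : probability T R)
    (c r w : T -> R) (K : R) :=
  [/\ measurable_fun [set: T] c, measurable_fun [set: T] r,
      measurable_fun [set: T] w, forall z, 0 <= w z &
  forall P : {poly R}, (forall x, 0 <= P.[x]) -> (size P <= N.+1)%N ->
   rel (\int[mu]_x (P.[x])%:E)%E
       (K%:E * \int[nu]_z (w z * circle_mean N (horner P) (c z) (r z))%:E)%E].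

(** The last n coordinates are replaced first. At that stage the integrand is,
    as a function of the first coordinate, a torus mean of polynomials, hence a
    polynomial to which the hypothesis on the first law applies; an integral
    with respect to the other laws might be infinite instead. *)
Lemma mixture_rel_tensor n (mu : 'I_n -> probability T1 R) (nu : 'I_n -> probability T R)
    (c r w : 'I_n -> T -> R) (K : 'I_n -> R) (h : n.-tuple T1 -> R) :
  (forall i, 0 <= K i) ->
  (forall i, mixture_rel (mu i) (nu i) (c i) (r i) (w i) (K i)) ->
  measurable_fun [set: n.-tuple T1] h -> (forall x, 0 <= h x) ->
  tuple_poly N h ->
  rel (\int[prod_probability mu]_x (h x)%:E)%E
      ((\prod_i K i)%:E * \int[prod_probability nu]_z
        ((\prod_i w i (tnth z i)) *
         torus_mean N (fun i => c i (tnth z i)) (fun i => r i (tnth z i)) h)%:E)%E.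
Proof.
elim: n mu nu c r w K h => [|n IH] mu nu c r w K h K0 mix mh h0 hP.
  rewrite /= !integral_dirac //; [ | |exact/measurable_EFinP]; last first.
    apply: (eq_measurable_fun (cst
      ((\prod_(i < 0) w i (tnth [tuple] i)) * torus_mean N (fun i => c i (tnth [tuple] i))
         (fun i => r i (tnth [tuple] i)) h)%:E)) => // z _.
    by rewrite (tuple0 z).
  rewrite !diracE !in_setT !mul1e !big_ord0 mul1r mul1e.
  rewrite /torus_mean expr0 mul1r (eq_bigr (fun=> h [tuple])); last first.
    by move=> p _; congr h; exact: tuple0.
  by rewrite sumr_const card_ffun !card_ord expn0; exact: rel_refl.
pose mu' i := mu (lift ord0 i); pose nu' i := nu (lift ord0 i).
pose K' := \prod_(i < n) K (lift ord0 i).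
have K'0 : 0 <= K' by apply: prodr_ge0.
pose c' (z : n.-tuple T) i := c (lift ord0 i) (tnth z i).
pose r' (z : n.-tuple T) i := r (lift ord0 i) (tnth z i).
pose w' (z : n.-tuple T) := \prod_i w (lift ord0 i) (tnth z i).
pose hx (x : T1) (y : n.-tuple T1) := h (tuple_cons (x, y)).
pose G x z := w' z * torus_mean N (c' z) (r' z) (hx x).
have w0 i z : 0 <= w i z by case: (mix i).
have w'0 z : 0 <= w' z by apply: prodr_ge0 => i _; exact: w0.
have tm0 x z : 0 <= torus_mean N (c' z) (r' z) (hx x).
  by apply: torus_mean_ge0 => y; exact: h0.
have G0 x z : 0 <= G x z by rewrite /G mulr_ge0.
have mhc : measurable_fun [set: T1 * n.-tuple T1] (h \o @tuple_cons _ T1 n).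
  by apply: measurableT_comp => //; exact: measurable_tuple_cons.
have mtn i : measurable_fun [set: n.-tuple T] (fun z => tnth z i) by exact: measurable_tnth.
have mw' : measurable_fun [set: n.-tuple T] w'.
  by apply: measurable_prod => i _; apply: measurableT_comp => //; case: (mix (lift ord0 i)).
have mG : measurable_fun [set: T1 * n.-tuple T] (fun xz => G xz.1 xz.2).
  apply: measurable_funM; first exact: measurableT_comp.
  apply: (@measurable_torus_mean _ _ _ _ _
    (fun i (xz : T1 * n.-tuple T) => c' xz.2 i) (fun i (xz : T1 * n.-tuple T) => r' xz.2 i)
    (fun xz => hx xz.1)).
  - move=> i; case: (mix (lift ord0 i)) => mc _ _ _ _.
    exact: (measurableT_comp mc (measurableT_comp (mtn i) measurable_snd)).
  - move=> i; case: (mix (lift ord0 i)) => _ mr _ _ _.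
    exact: (measurableT_comp mr (measurableT_comp (mtn i) measurable_snd)).
  - apply: (measurableT_comp mhc (f := _)).
    apply: measurable_fun_pair => //.
    exact: (measurableT_comp measurable_fst measurable_fst).
pose F x z := w ord0 x * w' z *
  circle_mean N (fun t => torus_mean N (c' z) (r' z) (hx t)) (c ord0 x) (r ord0 x).
have F0 x z : 0 <= F x z.
  rewrite /F /circle_mean mulr_ge0 ?mulr_ge0 // ?invr_ge0 //.
  by apply: sumr_ge0 => j _; exact: tm0.
have mF : measurable_fun [set: T * n.-tuple T] (fun xz => F xz.1 xz.2).
  case: (mix ord0) => mc0 mr0 mw0 _ _.
  have m1 (g : T -> R) : measurable_fun [set: T] g ->
      measurable_fun [set: T * n.-tuple T] (fun xz => g xz.1).
    by move=> mg; exact: measurableT_comp.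
  apply: measurable_funM.
    by apply: measurable_funM; [exact: m1|exact: measurableT_comp].
  apply: measurable_funM => //; apply: measurable_sum => j.
  pose t (xz : T * n.-tuple T) : T1 := c ord0 xz.1 + r ord0 xz.1 * cos (grid j).
  have mt : measurable_fun [set: T * n.-tuple T] t.
    by apply: measurable_funD; [exact: m1|apply: measurable_funM => //; exact: m1].
  apply: (@measurable_torus_mean _ _ _ _ _
    (fun i (xz : T * n.-tuple T) => c' xz.2 i) (fun i (xz : T * n.-tuple T) => r' xz.2 i)
    (fun xz => hx (t xz))).
  - move=> i; case: (mix (lift ord0 i)) => mc _ _ _ _.
    exact: (measurableT_comp mc (measurableT_comp (mtn i) measurable_snd)).
  - move=> i; case: (mix (lift ord0 i)) => _ mr _ _ _.
    exact: (measurableT_comp mr (measurableT_comp (mtn i) measurable_snd)).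
  - apply: (measurableT_comp mhc (f := _)).
    apply: measurable_fun_pair => //.
    exact: (measurableT_comp mt measurable_fst).
have mhE : measurable_fun [set: n.+1.-tuple T1] (EFin \o h) by exact/measurable_EFinP.
have h0E x : (0 <= (EFin \o h) x)%E by rewrite lee_fin.
rewrite (integral_prod_probability_cons mu mhE h0E).
have mGE : measurable_fun [set: T1 * n.-tuple T] (fun xz => (G xz.1 xz.2)%:E).
  exact/measurable_EFinP.
have mFE : measurable_fun [set: T * n.-tuple T] (fun xz => (F xz.1 xz.2)%:E).
  exact/measurable_EFinP.
have G0E (xz : T1 * n.-tuple T) : (0 <= (G xz.1 xz.2)%:E)%E by rewrite lee_fin.
have F0E (xz : T * n.-tuple T) : (0 <= (F xz.1 xz.2)%:E)%E by rewrite lee_fin.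
have mGx := measurable_fun_fubini_tonelli_F (m2 := prod_probability nu') _ mGE G0E.
have mGz := measurable_fun_fubini_tonelli_G (m1 := mu ord0) _ mGE G0E.
have mFz := measurable_fun_fubini_tonelli_G (m1 := nu ord0) _ mFE F0E.
have mhcE : measurable_fun [set: T1 * n.-tuple T1] (fun xy => (h (tuple_cons xy))%:E).
  exact/measurable_EFinP.
have hc0E (xy : T1 * n.-tuple T1) : (0 <= (h (tuple_cons xy))%:E)%E by rewrite lee_fin.
have mhx' := measurable_fun_fubini_tonelli_F (m2 := prod_probability mu') _ mhcE hc0E.
have IG0x x : (0 <= \int[prod_probability nu']_z (G x z)%:E)%E.
  by apply: integral_ge0 => y _; rewrite lee_fin.
have IG0z z : (0 <= \int[mu ord0]_x (G x z)%:E)%E.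
  by apply: integral_ge0 => y _; rewrite lee_fin.
have IF0z z : (0 <= \int[nu ord0]_x (F x z)%:E)%E.
  by apply: integral_ge0 => y _; rewrite lee_fin.
apply: (@rel_trans _ (\int[mu ord0]_x (K'%:E * \int[prod_probability nu']_z (G x z)%:E))%E).
  apply: rel_integral.
  - exact: mhx'.
  - by apply: measurable_funeM; exact: mGx.
  - by move=> x; apply: integral_ge0 => y _; rewrite lee_fin.
  - move=> x; apply: mule_ge0; first by rewrite lee_fin.
    by apply: integral_ge0 => y _; rewrite lee_fin.
  move=> x; have mhx : measurable_fun [set: n.-tuple T1] (hx x).
    exact: (measurableT_comp mhc (pair1_measurable x)).
  exact: (IH mu' nu' _ _ _ _ _ (fun i => K0 _) (fun i => mix (lift ord0 i)) mhx
    (fun y => h0 _) (hP.2 x)).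
have K'0E : (0 <= K'%:E)%E by rewrite lee_fin.
have K0E : (0 <= (K ord0)%:E)%E by rewrite lee_fin.
rewrite ge0_integralZl //.
rewrite (fubini_tonelli (fun xz => (G xz.1 xz.2)%:E)) //.
apply: (@rel_trans _ (K'%:E * \int[prod_probability nu']_z
    ((K ord0)%:E * \int[nu ord0]_x (F x z)%:E))%E).
  apply: rel_mul => //; apply: rel_integral.
  - exact: mGz.
  - by apply: measurable_funeM; exact: mFz.
  - exact: IG0z.
  - by move=> z; exact: mule_ge0.
  move=> z /=; have [P sP PE] := tuple_poly_torus_mean N (c' z) (r' z) (w' z) hP.
  case: (mix ord0) => _ _ _ _ /(_ P _ sP) H.
  have P0 x : 0 <= P.[x] by rewrite -PE; exact: G0.
  have -> : (\int[mu ord0]_x (G x z)%:E = \int[mu ord0]_x (P.[x])%:E)%E.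
    by apply: eq_integral => x _; rewrite -PE.
  have -> : (\int[nu ord0]_x (F x z)%:E = \int[nu ord0]_x (w ord0 x *
      circle_mean N (horner P) (c ord0 x) (r ord0 x))%:E)%E; last exact: H.
  apply: eq_integral => x _; congr (_%:E); rewrite /F -mulrA; congr (_ * _).
  rewrite /circle_mean mulrCA; congr (_ * _); rewrite mulr_sumr.
  by apply: eq_bigr => j _; rewrite -PE.
rewrite big_ord_recl ge0_integralZl //.
rewrite -(fubini_tonelli (fun xz => (F xz.1 xz.2)%:E)) //.
rewrite muleA -EFinM (mulrC K') integral_prod_probability_cons; last 2 first.
- apply/measurable_EFinP; apply: measurable_funM.
    apply: measurable_prod => i _; case: (mix i) => _ _ mwi _ _.
    exact: (measurableT_comp mwi (measurable_tnth i)).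
  apply: (@measurable_torus_mean _ _ _ _ _
    (fun i (z : n.+1.-tuple T) => c i (tnth z i)) (fun i (z : n.+1.-tuple T) => r i (tnth z i))
    (fun=> h)).
  - move=> i; case: (mix i) => mci _ _ _ _.
    exact: (measurableT_comp mci (measurable_tnth i)).
  - move=> i; case: (mix i) => _ mri _ _ _.
    exact: (measurableT_comp mri (measurable_tnth i)).
  - exact: measurableT_comp.
- move=> z; rewrite lee_fin mulr_ge0 ?torus_mean_ge0 //.
  exact: prodr_ge0.
have E : forall x z, F x z = (\prod_i w i (tnth (tuple_cons (x, z)) i)) *
    torus_mean N (fun i => c i (tnth (tuple_cons (x, z)) i))
      (fun i => r i (tnth (tuple_cons (x, z)) i)) h.
  move=> x z; rewrite torus_mean_cons big_ord_recl /F /tuple_cons /= !tnth0.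
  have S i : tnth [tuple of x :: z] (lift ord0 i) = tnth z i by exact: tnthS.
  congr (_ * _ * _); first by apply: eq_bigr => i _; rewrite S.
  have cE : (fun i => c (lift ord0 i) (tnth [tuple of x :: z] (lift ord0 i))) = c' z.
    by apply/funext => i; rewrite S.
  have rE : (fun i => r (lift ord0 i) (tnth [tuple of x :: z] (lift ord0 i))) = r' z.
    by apply/funext => i; rewrite S.
  by rewrite -[c' z]cE -[r' z]rE.
set A := (X in rel (_ * X)%E _); set B := (X in rel _ (_ * X)%E).
suff -> : A = B by exact: rel_refl.
by apply: eq_integral => x _; apply: eq_integral => z _; rewrite E.
Qed.

End Tensorization.

(** * Functions on tuples that are polynomial in each variable *)

Section TuplePoly.
Context {R : realType}.
Local Notation T1 := (measurableTypeR R).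

Lemma tuple_poly_ext D n (h h' : n.-tuple T1 -> R) :
  h =1 h' -> tuple_poly D h -> tuple_poly D h'.
Proof. by move=> /funext ->. Qed.

Lemma tuple_poly_le D E n (h : n.-tuple T1 -> R) :
  (D <= E)%N -> tuple_poly D h -> tuple_poly E h.
Proof.
move=> DE; elim: n h => [//|n IH] h [hP hT]; split=> [y|x]; last exact/IH/hT.
by have [P sP PE] := hP y; exists P => //; exact: leq_trans sP _.
Qed.

Lemma tuple_poly_cst D n (u : R) : tuple_poly D (fun _ : n.-tuple T1 => u).
Proof.
elim: n => [//|n IH]; split=> [y|x]; last exact: IH.
exists u%:P; first exact: leq_trans (size_polyC_leq1 _) _.
by move=> x; rewrite hornerC.
Qed.

Lemma tuple_poly_coord n (i : 'I_n) : tuple_poly 1 (fun x : n.-tuple T1 => tnth x i : R).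
Proof.
elim: n i => [[]//|n IH] i; case: (unliftP ord0 i) => [j ->|->]; split=> [y|x].
- exists (tnth y j)%:P; first exact: leq_trans (size_polyC_leq1 _) _.
  by move=> x; rewrite hornerC /tuple_cons /= tnthS.
- by apply: tuple_poly_ext (IH j) => y; rewrite /tuple_cons /= tnthS.
- by exists 'X; [rewrite size_polyX|move=> x; rewrite hornerX].
- by apply: tuple_poly_ext (tuple_poly_cst 1 n x) => y.
Qed.

Lemma tuple_polyD D n (h g : n.-tuple T1 -> R) :
  tuple_poly D h -> tuple_poly D g -> tuple_poly D (fun x => h x + g x).
Proof.
elim: n h g => [//|n IH] h g [hP hT] [gP gT]; split=> [y|x]; last exact: (IH _ _ (hT x) (gT x)).
have [P sP PE] := hP y; have [Q sQ QE] := gP y; exists (P + Q).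
  by apply: leq_trans (size_polyD _ _) _; rewrite geq_max sP.
by move=> x; rewrite hornerD PE QE.
Qed.

Lemma tuple_polyM D E n (h g : n.-tuple T1 -> R) :
  tuple_poly D h -> tuple_poly E g -> tuple_poly (D + E) (fun x => h x * g x).
Proof.
elim: n h g => [//|n IH] h g [hP hT] [gP gT]; split=> [y|x]; last exact: (IH _ _ (hT x) (gT x)).
have [P sP PE] := hP y; have [Q sQ QE] := gP y; exists (P * Q).
  by apply: leq_trans (size_polyMleq _ _) _; lia.
by move=> x; rewrite hornerM PE QE.
Qed.

Lemma tuple_polyX D n (h : n.-tuple T1 -> R) k :
  tuple_poly D h -> tuple_poly (k * D) (fun x => h x ^+ k).
Proof.
move=> Hh; elim: k => [|k IH].
  by apply: tuple_poly_ext (tuple_poly_cst _ n 1) => x; rewrite expr0.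
by rewrite mulSn; apply: tuple_poly_ext (tuple_polyM Hh IH) => x; rewrite exprS.
Qed.

Lemma tuple_poly_poly_fun D n (H : mpoly n R) :
  (msize H <= D.+1)%N -> tuple_poly D (poly_fun H).
Proof.
move=> HD.
have mono (m : multinom n) : tuple_poly (mdeg m)
    (fun x : n.-tuple T1 => mcoeff m H * \prod_i tnth x i ^+ m i).
  rewrite -[mdeg m]add0n; apply: tuple_polyM; first exact: tuple_poly_cst.
  rewrite mdegE.
  elim: (index_enum _) => [|i s IH].
    by rewrite big_nil; apply: tuple_poly_ext (tuple_poly_cst _ n 1) => x; rewrite big_nil.
  rewrite big_cons; have := tuple_polyM (tuple_polyX (m i) (tuple_poly_coord i)) IH.
  by rewrite muln1; apply: tuple_poly_ext => x; rewrite big_cons.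
apply: (@tuple_poly_ext _ _ (fun x => \sum_(m <- msupp H)
    mcoeff m H * \prod_i tnth x i ^+ m i)) => [x|].
  by rewrite /poly_fun mevalE.
have : forall m, m \in msupp H -> (mdeg m <= D)%N.
  by move=> m /msize_mdeg_lt mH; rewrite -ltnS (leq_trans mH).
elim: (msupp H) => [_|m s IH ms].
  by apply: tuple_poly_ext (tuple_poly_cst _ n 0) => x; rewrite big_nil.
apply: tuple_poly_ext (tuple_polyD (tuple_poly_le _ (mono m)) (IH _)) => [x||l ls].
- by rewrite big_cons.
- by apply: ms; rewrite mem_head.
- by apply: ms; rewrite in_cons ls orbT.
Qed.

Lemma measurable_poly_fun n (H : mpoly n R) :
  measurable_fun [set: n.-tuple T1] (poly_fun H).
Proof.
apply: (eq_measurable_fun (fun x : n.-tuple T1 => \sum_(m <- msupp H)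
    mcoeff m H * \prod_i tnth x i ^+ m i)) => [x _|].
  by rewrite /poly_fun mevalE.
apply: measurable_sum => m; apply: measurable_funM => //.
apply: measurable_prod => i _; apply: measurable_funX; exact: measurable_tnth.
Qed.

End TuplePoly.

(** * The integral form of the inequality *)

Section SumOfSquares.
Context {R : realType}.

Lemma prod_fiber_card (I J : finType) (s : J -> I) (a : I -> R) :
  \prod_i a i ^+ #|[pred j | s j == i]| = \prod_j a (s j).
Proof.
rewrite (partition_big s xpredT) //=; apply: eq_bigr => i _.
rewrite (eq_bigr (fun=> a i)); last by move=> j /eqP ->.
by rewrite -prodr_const; apply: eq_bigl => j; rewrite inE.
Qed.

Lemma expr_sum_ffun k n (a : 'I_n -> R) :
  (\sum_i a i) ^+ k = \sum_(s : {ffun 'I_k -> 'I_n}) \prod_j a (s j).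
Proof. by rewrite -[in LHS](card_ord k) -prodr_const bigA_distr_bigA. Qed.

End SumOfSquares.

Section GradientBound.
Context {R : realType}.
Local Notation T1 := (measurableTypeR R).
Local Notation T2 := (measurableTypeR R * measurableTypeR R)%type.

Lemma tuple_poly_prod D n k (h : 'I_k -> n.-tuple T1 -> R) :
  (forall j, tuple_poly D (h j)) -> tuple_poly (k * D) (fun x => \prod_j h j x).
Proof.
elim: k h => [|k IH] h H.
  by apply: tuple_poly_ext (tuple_poly_cst _ n 1) => x; rewrite big_ord0.
rewrite mulSn; apply: tuple_poly_ext (tuple_polyM (H ord0) (IH _ (fun j => H (lift ord0 j)))).
by move=> x; rewrite big_ord_recl.
Qed.

(** The power of |grad f|^2 is expanded into products of k + 1 squared partial
    derivatives, indexed by s. The comparison with radii, taken to the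
    multiplicity of i in s for each coordinate i, costs the same factor
    (8 M^2)^(k + 1) for every s, so the terms can be added up again, and
    [torus_markov] applies for each value of the centres and radii. *)
Theorem integral_gradient_le (k n d : nat) (mu : 'I_n -> probability T1 R)
    (rho : 'I_n -> R -> R) (M : R) (f : mpoly n R) :
  (0 < d)%N -> 0 < M ->
  (forall j, [/\ has_density (mu j) (rho j), unimodal (rho j) &
    {ae lebesgue_measure, forall x, rho j x <= M}]) ->
  degree_le d f ->
  (\int[prod_probability mu]_x
     ((\sum_i poly_fun (mderiv i f) x ^+ 2) ^+ k.+1)%:E <=
   ((8 * M ^+ 2) ^+ k.+1 * (8 * k.+1%:R * d%:R ^+ 2) ^+ k.+1.*2)%:E *
   \int[prod_probability mu]_x (poly_fun f x ^+ k.+1.*2)%:E)%E.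
Proof.
move=> d0 M0 Hrho fd.
(* Fine enough for [torus_markov], and for polynomials of degree 2 (k + 1) d. *)
pose N := (3 * (k.+1 * d) + 2)%N.
have /choice[t Ht] : forall j, exists t : probability T2 R * (T2 -> R) * (T2 -> R),
  [/\ measurable_fun [set: T2] t.1.2, measurable_fun [set: T2] t.2, forall z, 0 <= t.2 z &
   forall P : {poly R}, (forall x, 0 <= P.[x]) -> (size P <= N.+1)%N ->
   (\int[mu j]_x (P.[x])%:E =
    \int[t.1.1]_z (circle_mean N (horner P) (t.1.2 z) (t.2 z))%:E)%E /\
   forall k, (\int[mu j]_x (P.[x])%:E <= ((8 * M ^+ 2) ^+ k)%:E *
     \int[t.1.1]_z (t.2 z ^+ k.*2 * circle_mean N (horner P) (t.1.2 z) (t.2 z))%:E)%E].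
  move=> j; have [hd un ae] := Hrho j.
  have [nu [c [r [mc mr r0 H]]]] := arcsine_mixture hd un M0 ae.
  by exists (nu, c, r); split => // P P0 sP; exact: H.
pose nu j := (t j).1.1; pose c j := (t j).1.2; pose r j := (t j).2.
have mc j : measurable_fun [set: T2] (c j) by case: (Ht j).
have mr j : measurable_fun [set: T2] (r j) by case: (Ht j).
have r0 j z : 0 <= r j z by have [_ _ H _] := Ht j; exact: H.
pose g i := poly_fun (mderiv i f) : n.-tuple T1 -> R.
have mg i : measurable_fun [set: n.-tuple T1] (g i) by exact: measurable_poly_fun.
pose tm (h : n.-tuple T1 -> R) (z : n.-tuple T2) :=
  torus_mean N (fun i => c i (tnth z i)) (fun i => r i (tnth z i)) h.
have mtm h : measurable_fun [set: n.-tuple T1] h -> measurable_fun [set: n.-tuple T2] (tm h).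
  move=> mh; apply: (@measurable_torus_mean _ _ _ _ _
    (fun i (z : n.-tuple T2) => c i (tnth z i)) (fun i (z : n.-tuple T2) => r i (tnth z i))
    (fun=> h)).
  - by move=> i; exact: (measurableT_comp (mc i) (measurable_tnth i)).
  - by move=> i; exact: (measurableT_comp (mr i) (measurable_tnth i)).
  - exact: measurableT_comp.
pose A := 8 * M ^+ 2.
have A0 : 0 <= A by rewrite mulr_ge0 // sqr_ge0.
pose B := (8 * k.+1%:R * d%:R ^+ 2) ^+ k.+1.*2 : R.
have B0 : 0 <= B by rewrite exprn_even_ge0 //= odd_double.
pose F x := poly_fun f x ^+ k.+1.*2 : R.
have F0 x : 0 <= F x by rewrite exprn_even_ge0 //= odd_double.
have mF : measurable_fun [set: n.-tuple T1] F.
  by apply: measurable_funX; exact: measurable_poly_fun.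
have EF : (\int[prod_probability mu]_x (F x)%:E =
           \int[prod_probability nu]_z (tm F z)%:E)%E.
  have := @mixture_rel_tensor R _ T2 N eq (@erefl _) (@eq_trans _) _ _ n mu nu c r
    (fun _ => cst 1) (fun=> 1) F.
  rewrite big1_eq mul1e => H; apply: etrans (H _ _ _ _ _ _ _) _.
  - by move=> ? ? ? _ ->.
  - by move=> ? ? ? ? ? _ _ _ _ fg; apply: eq_integral => x _; exact: fg.
  - by [].
  - move=> i; split => // P P0 sP; case: (Ht i) => _ _ _ /(_ P P0 sP)[-> _].
    by rewrite mul1e; apply: eq_integral => z _; rewrite mul1r.
  - exact: mF.
  - exact: F0.
  - apply: tuple_poly_le (tuple_polyX k.+1.*2 (tuple_poly_poly_fun fd)).
    by rewrite /N -mul2n -mulnA; lia.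
  by apply: eq_integral => z _; rewrite mul1r.
pose h (s : {ffun 'I_k.+1 -> 'I_n}) x := \prod_j g (s j) x ^+ 2.
have h0 s x : 0 <= h s x by apply: prodr_ge0 => j _; exact: sqr_ge0.
have mh s : measurable_fun [set: n.-tuple T1] (h s).
  by apply: measurable_prod => j _; exact: measurable_funX.
pose W (s : {ffun 'I_k.+1 -> 'I_n}) (z : n.-tuple T2) := \prod_j r (s j) (tnth z (s j)) ^+ 2.
have W0 s z : 0 <= W s z by apply: prodr_ge0 => j _; exact: sqr_ge0.
have mW s : measurable_fun [set: n.-tuple T2] (W s).
  apply: measurable_prod => j _; apply: measurable_funX.
  exact: (measurableT_comp (mr (s j)) (measurable_tnth (s j))).
have tm0 s z : 0 <= tm (h s) z by apply: torus_mean_ge0; exact: h0.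
have Hs s : (\int[prod_probability mu]_x (h s x)%:E <=
    (A ^+ k.+1)%:E * \int[prod_probability nu]_z (W s z * tm (h s) z)%:E)%E.
  pose e i := #|[pred j | s j == i]|.
  have := @mixture_rel_tensor R _ T2 N (fun a b => (a <= b)%E) (fun a => lexx a)
    (fun a b e ab be => le_trans ab be) _ _ n mu nu c r
    (fun i z => r i z ^+ (e i).*2) (fun i => A ^+ e i) (h s).
  rewrite (prod_fiber_card s (fun=> A)) prodr_const card_ord => H.
  apply: le_trans (H _ _ _ _ _ _ _) _.
  - by move=> a b x a0; apply: lee_wpmul2l; rewrite lee_fin.
  - move=> d' S m f1 f2 mf1 mf2 f10 f20 f12.
    by apply: ge0_le_integral.
  - by move=> i; rewrite exprn_ge0.
  - move=> i; split => //.
    + exact: measurable_funX.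
    + by move=> z; rewrite exprn_ge0.
    + by move=> P P0 sP; case: (Ht i) => _ _ _ /(_ P P0 sP)[_ ]; exact.
  - exact: mh.
  - exact: h0.
  - apply: tuple_poly_le (tuple_poly_prod (fun j => tuple_polyX 2
      (tuple_poly_poly_fun (msize_mderiv_le (s j) fd)))).
    rewrite /N; have : (k.+1 * (2 * d.-1) <= k.+1 * (2 * d))%N by rewrite !leq_mul // leq_pred.
    by rewrite mulnCA; lia.
  rewrite le_eqVlt; apply/orP; left; apply/eqP; congr (_ * _)%E.
  apply: eq_integral => z _; congr ((_ * _)%:E).
  apply: etrans (prod_fiber_card s (fun i => r i (tnth z i) ^+ 2)).
  by apply: eq_bigr => i _; rewrite -exprM mul2n.
have key z : \sum_s W s z * tm (h s) z <= B * tm F z.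
  rewrite /tm /torus_mean; under eq_bigr do rewrite mulrCA.
  rewrite -mulr_sumr [leRHS]mulrCA ler_wpM2l ?exprn_ge0 ?invr_ge0 //.
  under eq_bigr do rewrite mulr_sumr.
  rewrite exchange_big /=.
  have dN : (3 * (k.+1 * d) + 3 <= N.+1)%N by rewrite /N; lia.
  have := torus_markov (fun i => c i (tnth z i)) (fun i => r i (tnth z i)) d0 dN fd.
  set L := (X in X <= _ -> _); set Q := (X in _ <= X -> _).
  rewrite (_ : L = \sum_(p : {ffun 'I_n -> 'I_N.+1}) \sum_s W s z * h s
     [tuple torus_point (fun i => c i (tnth z i)) (fun i => r i (tnth z i)) p i | i < n]).
    move=> /le_trans; apply; rewrite /Q -/B; rewrite ler_wpM2l //.
    apply: ler_sum => p _; rewrite /F /poly_fun le_eqVlt; apply/orP; left; apply/eqP.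
    by congr (_ ^+ _); apply: meval_eq => i; rewrite tnth_mktuple.
  apply: eq_bigr => p _; rewrite expr_sum_ffun; apply: eq_bigr => s _.
  rewrite /W /h -big_split; apply: eq_bigr => j _ /=; congr (_ * _ ^+ _).
  by apply: meval_eq => i; rewrite tnth_mktuple.
under eq_integral do rewrite expr_sum_ffun -sumEFin.
rewrite ge0_integral_sum //; last 2 first.
- by move=> s; apply/measurable_EFinP; exact: mh.
- by move=> s x _; rewrite lee_fin h0.
apply: (@le_trans _ _ (\sum_s ((A ^+ k.+1)%:E *
    \int[prod_probability nu]_z (W s z * tm (h s) z)%:E))%E).
  by apply: lee_sum => s _; exact: Hs.
rewrite -ge0_sume_distrr; last first.
  by move=> s _; apply: integral_ge0 => z _; rewrite lee_fin mulr_ge0.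
rewrite EFinM -muleA lee_wpmul2l ?lee_fin ?exprn_ge0 //.
rewrite -ge0_integral_sum //; last 2 first.
- by move=> s; apply/measurable_EFinP; apply: measurable_funM => //; exact: mtm.
- by move=> s z _; rewrite lee_fin mulr_ge0.
have mtF : measurable_fun [set: n.-tuple T2] (fun z => (tm F z)%:E).
  by apply/measurable_EFinP; exact: mtm.
have tF0 z : (0 <= (tm F z)%:E)%E by rewrite lee_fin torus_mean_ge0.
have BE : (0 <= B%:E)%E by rewrite lee_fin.
rewrite EF -(ge0_integralZl (prod_probability nu) measurableT mtF (fun z _ => tF0 z) BE).
apply: ge0_le_integral => //.
- by move=> z _; rewrite sumEFin lee_fin sumr_ge0 // => s _; rewrite mulr_ge0.
- apply: emeasurable_sum => s; apply/measurable_EFinP.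
  by apply: measurable_funM => //; exact: mtm.
- by apply: measurable_funeM; apply/measurable_EFinP; exact: mtm.
- by move=> z _; rewrite sumEFin -EFinM lee_fin; exact: key.
Qed.

End GradientBound.

(** * Norms and constants *)

Section NormBounds.
Context {R : realType}.

(** The essential supremum is positive because a density that vanishes almost
    everywhere has integral 0. *)
Lemma ess_sup_density_bound (mu : probability (measurableTypeR R) R) (rho : R -> R) :
  has_density mu rho -> bounded_fun rho ->
  exists m : R, [/\ 0 < m,
    ('N[lebesgue_measure]_+oo[EFin \o rho])%E = m%:E &
    {ae lebesgue_measure, forall x, rho x <= m}].
Proof.
move=> [mrho rho0 muE] [B [_ HB]].
have leb0 : (0 < (@lebesgue_measure R) [set: R])%E.
  by rewrite -set_itvNyy lebesgue_measure_itv /= ?ltNyy ?ltry.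
set L := Lnorm lebesgue_measure +oo%E (EFin \o rho).
have LE : L = ess_sup lebesgue_measure (abse \o (EFin \o rho)).
  by rewrite /L unlock leb0.
have L0 : (0 <= L)%E by exact: Lnorm_ge0.
have LB : (L <= (B + 1)%:E)%E.
  rewrite LE; apply/ess_supP/nearW => x /=; rewrite lee_fin.
  have BB : B < B + 1 by rewrite ltrDl.
  exact: (HB _ BB x Logic.I).
have Lfin : L \is a fin_num by rewrite ge0_fin_numE // (le_lt_trans LB) ?ltry.
have ae_le : {ae lebesgue_measure, forall x, rho x <= fine L}.
  have := ess_sup_ge lebesgue_measure (abse \o (EFin \o rho)).
  rewrite -LE; apply: negligibleS => x /=; apply: contra_not => H.
  by rewrite -lee_fin fineK // (le_trans _ H) // lee_fin ler_norm.
exists (fine L); split; [|by rewrite fineK|by []].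
rewrite lt_neqAle eq_sym fine_ge0 // andbT; apply/eqP => Lz.
have : (1 <= 0 :> \bar R)%E; last by rewrite lee_fin ler10.
rewrite -(@probability_setT _ _ _ mu).
apply: (@le_trans _ _ (\int[lebesgue_measure]_(x in [set: R]) (rho x)%:E)%E).
  by rewrite le_eqVlt; apply/orP; left; apply/eqP; exact: muE.
rewrite -[leRHS](@integral0 _ _ _ lebesgue_measure [set: R]).
apply: ae_ge0_le_integral => //.
- by move=> x _; rewrite lee_fin.
- exact/measurable_EFinP.
- by move: ae_le; rewrite Lz; apply: negligibleS => x /=; apply: contra_not => H _; rewrite lee_fin.
Qed.

Lemma max_ess_sup_bound n (mu : 'I_n -> probability (measurableTypeR R) R)
    (rho : 'I_n -> R -> R) : (0 < n)%N ->
  (forall j, has_density (mu j) (rho j)) -> (forall j, bounded_fun (rho j)) ->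
  exists M : R, [/\ 0 < M,
    (\big[maxe/-oo]_(j < n) 'N[lebesgue_measure]_+oo[EFin \o rho j])%E = M%:E &
    forall j, {ae lebesgue_measure, forall x, rho j x <= M}].
Proof.
move=> n0 hd bd.
have /choice[m Hm] : forall j, exists m : R, [/\ 0 < m,
    ('N[lebesgue_measure]_+oo[EFin \o rho j])%E = m%:E &
    {ae lebesgue_measure, forall x, rho j x <= m}].
  by move=> j; exact: ess_sup_density_bound.
under eq_bigr => j _ do rewrite (let: And3 _ E _ := Hm j in E).
set X := (\big[_/_]_(j < n) _)%E.
have mX j : ((m j)%:E <= X)%E by rewrite /X (bigD1 j) //= le_max lexx.
have Xlt : (X < +oo)%E.
  rewrite /X; elim/big_ind: _ => //; last by move=> j _; rewrite ltry.
  by move=> x y xoo yoo; rewrite gt_max xoo.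
have Xgt : (0 < X)%E.
  apply: lt_le_trans (mX (Ordinal n0)); rewrite lte_fin.
  by case: (Hm (Ordinal n0)).
have Xfin : X \is a fin_num by rewrite ge0_fin_numE // ltW.
exists (fine X); split; [by rewrite fine_gt0 // Xgt|by rewrite fineK|move=> j].
have [_ _ ae] := Hm j; apply: negligibleS ae => x /=; apply: contra_not => H.
by rewrite (le_trans H) // -lee_fin fineK.
Qed.

Lemma Lnorm_even d (T : measurableType d) (mu : {measure set T -> \bar R})
    (h : T -> R) k :
  ('N[mu]_((2 * k)%:R)%:E[EFin \o h] =
   (\int[mu]_x (h x ^+ (2 * k))%:E) `^ ((2 * k)%:R^-1))%E.
Proof.
rewrite unlock; congr (_ `^ _)%E; apply: eq_integral => x _ /=.
rewrite powR_mulrn // -normrX ger0_norm //.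
by rewrite exprn_even_ge0 // mul2n odd_double.
Qed.

Lemma poweR_root_le (X Y : \bar R) (b : R) p : (0 < p)%N -> 0 <= b ->
  (0 <= X)%E -> (0 <= Y)%E -> (X <= (b ^+ p)%:E * Y)%E ->
  (X `^ p%:R^-1 <= b%:E * Y `^ p%:R^-1)%E.
Proof.
move=> p0 b0 X0 Y0 XY.
have bp0 : (0 <= (b ^+ p)%:E)%E by rewrite lee_fin exprn_ge0.
apply: (@le_trans _ _ (((b ^+ p)%:E * Y) `^ p%:R^-1)%E).
  by apply: gt0_ler_poweR; rewrite ?invr_ge0 // in_itv /= leey andbT ?mule_ge0.
rewrite poweRM // poweR_EFin -powR_mulrn // -powRrM divff ?powRr1 //.
by rewrite pnatr_eq0 -lt0n.
Qed.

End NormBounds.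

Section MarkovConstant.
Variable R : realType.

Definition markov_constant (k : nat) : R :=
  if (k <= 1)%N then 24%:R else 736%:R * k%:R ^+ 3.

Lemma markov_constant_gt0 k : (1 <= k)%N -> 0 < markov_constant k.
Proof.
move=> k0; rewrite /markov_constant; case: ifP => _; first by rewrite ltr0n.
by apply: mulr_gt0; [rewrite ltr0n|apply: exprn_gt0; rewrite ltr0n].
Qed.

Lemma markov_constant1 : markov_constant 1 = 24%:R.
Proof. by rewrite /markov_constant leqnn. Qed.

Lemma markov_constantE k : (2 <= k)%N -> markov_constant k = 736%:R * k%:R ^+ 3.
Proof. by move=> k2; rewrite /markov_constant leqNgt k2. Qed.

(** The factor 8 comes with the squared radii and the factors 8 k from
    [torus_markov]; the left-hand side is 512 k^2, against 576 when k = 1. *)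
Lemma markov_constant_ge k : (1 <= k)%N ->
  8 * (8 ^+ 2 * k%:R ^+ 2) <= markov_constant k ^+ 2.
Proof.
move=> k1; rewrite /markov_constant; case: ifP => [k_le1|_].
  have -> : k = 1%N by apply/eqP; rewrite eqn_leq k_le1.
  by rewrite expr1n mulr1; lra.
apply: (@le_trans _ _ ((736 * k%:R) ^+ 2)).
  have : 0 <= k%:R ^+ 2 :> R by exact: sqr_ge0.
  by rewrite exprMn; move: (k%:R ^+ 2) => z z0; lra.
have c0 : 0 <= 736%:R :> R by rewrite ler0n.
have k0 : 0 <= k%:R :> R by rewrite ler0n.
apply: lerXn2r; rewrite ?nnegrE; [exact: mulr_ge0|exact: mulr_ge0 (exprn_ge0 3 k0)|].
apply: (ler_wpM2l c0).
by rewrite -natrX ler_nat -{1}(expn1 k) leq_pexp2l.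
Qed.

End MarkovConstant.

Theorem theorem1p6 (R : realType) :
  exists C : nat -> R,
    [/\ forall k : nat, (1 <= k)%N -> 0 < C k,
        C 1%N = 24%:R,
        forall k : nat, (2 <= k)%N -> C k = 736%:R * k%:R ^+ 3 &
        forall (k n d : nat), (1 <= k)%N -> (1 <= n)%N -> (1 <= d)%N ->
        forall (mu : 'I_n -> probability (measurableTypeR R) R)
               (rho : 'I_n -> R -> R),
        (forall j : 'I_n,
           [/\ has_density (mu j) (rho j), bounded_fun (rho j)
             & unimodal (rho j)]) ->
        let M : \bar R := (\big[maxe/-oo]_(j < n)
                   'N[lebesgue_measure]_+oo[EFin \o rho j])%E in
        forall f : mpoly n R, degree_le d f ->
        ('N[prod_probability mu]_((2 * k)%:R)%:E[EFin \o grad_norm f] <=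
         (C k)%:E * M * (d%:R ^+ 2)%:E *
         'N[prod_probability mu]_((2 * k)%:R)%:E[EFin \o poly_fun f])%E].
Proof.
exists (@markov_constant R); split.
- exact: markov_constant_gt0.
- exact: markov_constant1.
- exact: markov_constantE.
move=> k n d k1 n1 d1 mu rho Hrho M f fd.
have hd j : has_density (mu j) (rho j) by case: (Hrho j).
have bd j : bounded_fun (rho j) by case: (Hrho j).
have [m [m0 ME aem]] := max_ess_sup_bound n1 hd bd.
rewrite /M ME -!EFinM !Lnorm_even.
have grad0 x : 0 <= \sum_i poly_fun (mderiv i f) x ^+ 2.
  by apply: sumr_ge0 => i _; exact: sqr_ge0.
apply: poweR_root_le.
- by rewrite muln_gt0.
- by rewrite !mulr_ge0 ?sqr_ge0 // ltW // markov_constant_gt0.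
- by apply: integral_ge0 => x _; rewrite lee_fin exprn_even_ge0 // mul2n odd_double.
- by apply: integral_ge0 => x _; rewrite lee_fin exprn_even_ge0 // mul2n odd_double.
have Hmu j : [/\ has_density (mu j) (rho j), unimodal (rho j) &
    {ae lebesgue_measure, forall x, rho j x <= m}] by split; [|case: (Hrho j)|].
have [k' kE] : exists k', k = k'.+1 by exists k.-1; rewrite prednK.
under eq_integral => x _ do rewrite exprM (sqr_sqrtr (grad0 x)).
have := @integral_gradient_le R k' n d mu rho m f d1 m0 Hmu fd.
rewrite -kE -mul2n => /le_trans; apply; apply: lee_wpmul2r.
  by apply: integral_ge0 => x _; rewrite lee_fin exprn_even_ge0 // mul2n odd_double.
rewrite lee_fin !exprM -exprMn lerXn2r ?nnegrE //.
- by rewrite mulr_ge0 ?sqr_ge0 // mulr_ge0 ?sqr_ge0.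
- exact: sqr_ge0.
rewrite !exprMn.
have Ck := markov_constant_ge R k1.
apply: (@le_trans _ _ (8 * (8 ^+ 2 * k%:R ^+ 2) * m ^+ 2 * (d%:R ^+ 2) ^+ 2)).
  by rewrite le_eqVlt; apply/orP; left; apply/eqP; ring.
by rewrite ler_wpM2r ?sqr_ge0 // ler_wpM2r ?sqr_ge0.
Qed.
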